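(* There exists a separable, locally uniformly convex real Banach space $X$ such that for every compact convex subset $K\subset X$ with at least two points, the nearest point map from $X$ onto $K$ is continuous but not uniformly continuous. Moreover, for every infinite-dimensional separable real Banach space $Y$ and every $\varepsilon>0$, there exists a locally uniformly convex Banach space $Z$ such that $Y$ is $(1+\varepsilon)$-isomorphic to $Z$ and, for every compact convex subset $K\subset Z$ with at least two points, the nearest point map from $Z$ onto $K$ is continuous but not uniformly continuous.
   Context: All Banach spaces are real. A Banach space $(X,\|\cdot\|)$ with unit sphere $S_X$ is locally uniformly convex if for every $x\in S_X$ and every sequence $(y_n)_n\subset S_X$ with $\left\|\frac{x+y_n}{2}\right\|\to 1$ one has $\|x-y_n\|\to 0$. Every locally uniformly convex space is strictly convex. For a subset $K$ of a Banach space $X$, a map $R\colon X\to K$ is a nearest point map onto $K$ if $\|x-R(x)\|=\inf\{\|x-k\|\colon k\in K\}$ for all $x\in X$. In a strictly convex Banach space, the nearest point map onto any nonempty compact convex set exists and is unique. Continuity and uniform continuity are with respect to the norm distance of the space. Two Banach spaces $(X,\|\cdot\|_X)$ and $(Y,\|\cdot\|_Y)$ are $(1+\varepsilon)$-isomorphic if there is a linear isomorphism $T\colon X\to Y$ with $\|T\|\,\|T^{-1}\|\leq 1+\varepsilon$. *)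

(* Defs.v *)
From HB Require Import structures.
From mathcomp Require Import all_boot all_order all_algebra.
From mathcomp Require Import all_classical all_reals all_analysis.

Set Implicit Arguments.
Unset Strict Implicit.
Unset Printing Implicit Defensive.

Import Order.TTheory GRing.Theory Num.Theory.
Import numFieldNormedType.Exports.

Local Open Scope classical_set_scope.
Local Open Scope ring_scope.

Definition separable (T : topologicalType) : Prop :=
  exists2 D : set T, countable D & dense D.

Definition locally_uniformly_convex (R : realType) (X : normedModType R) :
    Prop :=
  forall (x : X) (y : nat -> X), `|x| = 1 -> (forall n, `|y n| = 1) ->
    `|2^-1 *: (x + y n)| @[n --> \oo] --> (1 : R) ->
    `|x - y n| @[n --> \oo] --> (0 : R).

Definition finite_dimensional (R : realType) (X : lmodType R) : Prop :=
  exists (n : nat) (e : 'I_n -> X),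
    forall x : X, exists a : 'I_n -> R, x = \sum_(i < n) a i *: e i.

(* A map X -> K is represented by a map X -> X with values in K. *)
Definition nearest_point_map (R : realType) (X : normedModType R)
    (K : set X) (f : X -> X) : Prop :=
  forall x, K (f x) /\ `|x - f x| = inf [set `|x - k| | k in K].

(* [unique] makes f *the* nearest point map onto K: it exists and any other
   nearest point map onto K is equal to it. *)
Definition compact_convex_nearest_not_unif (R : realType)
    (X : normedModType R) : Prop :=
  forall K : set X, compact K -> convex_set K ->
    (exists x y, [/\ K x, K y & x != y]) ->
    exists f : X -> X,
      [/\ unique (nearest_point_map K) f, continuous f & ~ unif_continuous f].

(* Meaningful for continuous f only: [sup] of an unbounded set is 0. *)
Definition opnorm (R : realType) (X Y : normedModType R) (f : X -> Y) : R :=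
  sup [set `|f x| | x in [set x : X | `|x| <= 1]].

Definition isomorphic_with_const (R : realType) (c : R)
    (X Y : normedModType R) : Prop :=
  exists (T : {linear X -> Y}) (S : {linear Y -> X}),
    [/\ cancel T S, cancel S T, continuous T, continuous S
      & opnorm T * opnorm S <= c].

(* Main.v *)
From HB Require Import structures.
Require Import Defs.
From mathcomp Require Import all_boot all_order all_algebra.
From mathcomp Require Import all_classical all_reals all_analysis.
From mathcomp Require Import ring lra.

(* Kinks. Let x = t e + y with t large. The nearest point to x in K is governed by
   the directional derivative of the norm at e. If this derivative is, up to a
   small error on K, of the form const + kappa |psi(y)| with psi = theta g on K
   and psi(w) >= 1/2 for a unit vector w, then the nearest point to t e + delta w
   almost maximises g on K and the one to t e - delta w almost minimises it,
   where delta is of the order of theta. Since theta is arbitrarily small, the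
   nearest point map is not uniformly continuous as soon as g is not constant on K.

   The norm. Riesz's lemma gives unit vectors e_i and functionals chi_i of norm at
   most 1 with chi_i(e_i) close to 1 which vanish on larger and larger finite
   sets of a dense sequence (v_i), hence tend to 0 uniformly on compact sets. The
   norm max(|x|, sup_n c_n (|chi_n| + kappa |psi_n|)) with increasing weights c_n
   coincides with its n-th term near e_n after thinning out the sequence, and
   psi_n can be chosen to be theta g on any finite set of v_i's for each g in a
   separating sequence of functionals. Adding (in the l2 sense) small multiples
   of the distances q_i to the lines R v_i, taken in the norm without the kinks
   psi_n, makes the norm locally uniformly convex; for v_i in the kernel of chi_n,
   q_i = c_n |chi_n| near e_n, so the kinks are not disturbed. *)

Set Implicit Arguments.
Unset Strict Implicit.
Unset Printing Implicit Defensive.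

Import Order.TTheory GRing.Theory Num.Theory.
Import numFieldNormedType.Exports.

Local Open Scope classical_set_scope.
Local Open Scope ring_scope.

(** * Seminorms and the Hahn-Banach theorem *)

Section Seminorms.
Context {R : realType} {V : lmodType R}.
Implicit Types (p q : V -> R) (x y : V).

Definition seminorm p :=
  (forall x y, p (x + y) <= p x + p y) /\ (forall a x, p (a *: x) = `|a| * p x).

Lemma seminorm0 p : seminorm p -> p 0 = 0.
Proof. by move=> [_ pZ]; rewrite -(scale0r 0) pZ normr0 mul0r. Qed.

Lemma seminormN p x : seminorm p -> p (- x) = p x.
Proof. by move=> [_ pZ]; rewrite -scaleN1r pZ normrN1 mul1r. Qed.

Lemma seminorm_ge0 p x : seminorm p -> 0 <= p x.
Proof.
move=> sp; have := sp.1 x (- x).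
by rewrite subrr (seminorm0 sp) (seminormN _ sp) -mulr2n pmulrn_lge0.
Qed.

Lemma seminormBC p x y : seminorm p -> p (x - y) = p (y - x).
Proof. by move=> sp; rewrite -(seminormN _ sp) opprB. Qed.

Lemma seminorm_leB p x y : seminorm p -> p x - p y <= p (x - y).
Proof. by move=> sp; rewrite lerBlDr; have := sp.1 (x - y) y; rewrite subrK. Qed.

Lemma seminorm_distB p x y : seminorm p -> `|p x - p y| <= p (x - y).
Proof.
move=> sp; rewrite ler_norml seminorm_leB // andbT lerNl opprB seminormBC //.
exact: seminorm_leB.
Qed.

(** Applying the one-sided bound to [a^-1] and [a *: x] reverses it, so suprema and infima of
    seminorms only have to be bounded from above. *)
Lemma seminormW p : (forall x y, p (x + y) <= p x + p y) ->
  (forall a x, p (a *: x) <= `|a| * p x) -> seminorm p.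
Proof.
move=> pD pZ; split=> // a x; have [->|a0] := eqVneq a 0.
  have p0 : p 0 = 0.
    apply/eqP; rewrite eq_le; apply/andP; split.
      by have := pZ 0 0; rewrite scale0r normr0 mul0r.
    by have := pD 0 0; rewrite addr0; lra.
  by rewrite scale0r normr0 mul0r.
apply/eqP; rewrite eq_le pZ /=.
have := pZ a^-1 (a *: x); rewrite scalerA mulVf // scale1r normfV.
by rewrite -(@ler_pM2l _ `|a|) ?normr_gt0 // mulrA divff ?normr_eq0 // mul1r.
Qed.

Lemma seminorm_lin (f : {linear V -> R^o}) : seminorm (fun x => `|f x|).
Proof.
split=> [x y|a x]; first by rewrite linearD ler_normD.
by rewrite linearZ /= normrM.
Qed.

Lemma seminormD p q : seminorm p -> seminorm q -> seminorm (fun x => p x + q x).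
Proof.
move=> [pD pZ] [qD qZ]; split=> [x y|a x]; last by rewrite pZ qZ mulrDr.
by rewrite addrACA lerD.
Qed.

Lemma seminormM c p : 0 <= c -> seminorm p -> seminorm (fun x => c * p x).
Proof.
move=> c0 [pD pZ]; split=> [x y|a x]; last by rewrite pZ mulrCA.
by rewrite -mulrDr ler_wpM2l.
Qed.

Lemma seminorm_max p q : seminorm p -> seminorm q ->
  seminorm (fun x => Num.max (p x) (q x)).
Proof.
move=> [pD pZ] [qD qZ]; split=> [x y|a x]; last by rewrite pZ qZ maxr_pMr.
by rewrite ge_max; apply/andP; split;
  [apply: le_trans (pD x y) _|apply: le_trans (qD x y) _];
  apply: lerD; rewrite le_max lexx ?orbT.
Qed.

Definition hypot p q x := Num.sqrt (p x ^+ 2 + q x ^+ 2).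

Lemma hypot_sqr p q x : hypot p q x ^+ 2 = p x ^+ 2 + q x ^+ 2.
Proof. by rewrite sqr_sqrtr // addr_ge0 ?sqr_ge0. Qed.

Lemma hypot_ge0 p q x : 0 <= hypot p q x. Proof. exact: sqrtr_ge0. Qed.

Lemma seminorm_hypot p q : seminorm p -> seminorm q -> seminorm (hypot p q).
Proof.
move=> sp sq; split=> [x y|a x]; last first.
  rewrite /hypot sp.2 sq.2 !exprMn -mulrDr sqrtrM ?sqr_ge0 //.
  by rewrite sqrtr_sqr normr_id.
have [p1 p2 p3] : [/\ 0 <= p x, 0 <= p y & 0 <= p (x + y)].
  by split; exact: seminorm_ge0.
have [q1 q2 q3] : [/\ 0 <= q x, 0 <= q y & 0 <= q (x + y)].
  by split; exact: seminorm_ge0.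
have h0 := addr_ge0 (hypot_ge0 p q x) (hypot_ge0 p q y).
rewrite -(@ler_pXn2r _ 2) ?nnegrE ?hypot_ge0 // hypot_sqr sqrrD !hypot_sqr.
apply: (@le_trans _ _ ((p x + p y) ^+ 2 + (q x + q y) ^+ 2)).
  by apply: lerD; rewrite ler_pXn2r ?nnegrE ?addr_ge0 // ?sp.1 ?sq.1.
(* What remains is Cauchy-Schwarz in the plane, obtained from Lagrange's identity. *)
suff : p x * p y + q x * q y <= hypot p q x * hypot p q y by lra.
rewrite -(@ler_pXn2r _ 2) ?nnegrE ?addr_ge0 ?mulr_ge0 ?hypot_ge0 //.
rewrite exprMn !hypot_sqr -subr_ge0.
have -> : (p x ^+ 2 + q x ^+ 2) * (p y ^+ 2 + q y ^+ 2) -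
  (p x * p y + q x * q y) ^+ 2 = (p x * q y - q x * p y) ^+ 2 by ring.
exact: sqr_ge0.
Qed.

(** * Suprema of sequences of seminorms and quotient seminorms *)

Definition supn (p : nat -> V -> R) x := sup (range (p^~ x)).

(** [sup] of an unbounded set is 0 by convention, so [supn] is the true supremum only under this
    condition. *)
Definition pbounded (p : nat -> V -> R) :=
  forall x, exists B, forall n, p n x <= B.

Lemma supn_ge (p : nat -> V -> R) n x : pbounded p -> p n x <= supn p x.
Proof.
move=> /(_ x)[B pB]; apply: ub_le_sup; last by exists n.
by exists B => _ [m _ <-].
Qed.

Lemma supn_le (p : nat -> V -> R) x B : (forall n, p n x <= B) -> supn p x <= B.
Proof.
move=> pB; apply: ge_sup; first by exists (p 0%N x); exists 0%N.
by move=> _ [n _ <-].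
Qed.

Lemma seminorm_supn (p : nat -> V -> R) : pbounded p -> (forall n, seminorm (p n)) ->
  seminorm (supn p).
Proof.
move=> pB sp; apply: seminormW => [x y|a x]; apply: supn_le => n.
  by apply: le_trans ((sp n).1 x y) _; apply: lerD; exact: supn_ge.
by rewrite (sp n).2 ler_wpM2l // supn_ge.
Qed.

Definition subsp (S : set V) :=
  S 0 /\ (forall a x y, S x -> S y -> S (a *: x + y)).

(** The distance to [S] measured by [p]: the quotient seminorm on V/S, pulled back to V. *)
Definition quo p (S : set V) x := inf [set p (x - y) | y in S].

Section Quo.
Variables (p : V -> R) (S : set V).
Hypotheses (sp : seminorm p) (sS : subsp S).

Lemma quo_le x y : S y -> quo p S x <= p (x - y).
Proof.
move=> Sy; apply: ge_inf; last by exists y.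
by exists 0 => _ [z _ <-]; exact: seminorm_ge0.
Qed.

Lemma quo_ge x c : (forall y, S y -> c <= p (x - y)) -> c <= quo p S x.
Proof.
move=> h; apply: lb_le_inf; first by exists (p (x - 0)); exists 0 => //; exact: sS.1.
by move=> _ [y Sy <-]; exact: h.
Qed.

Lemma quo_lt x e : 0 < e -> exists2 y, S y & p (x - y) < quo p S x + e.
Proof.
move=> e0; have : has_inf [set p (x - y) | y in S].
  split; first by exists (p (x - 0)); exists 0 => //; exact: sS.1.
  by exists 0 => _ [z _ <-]; exact: seminorm_ge0.
by move=> /(inf_adherent e0)[_ [y Sy <-] ?]; exists y.
Qed.

Lemma quo_le_id x : quo p S x <= p x.
Proof. by rewrite -[in leRHS](subr0 x); apply: quo_le; exact: sS.1. Qed.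

Lemma quo_eq0 y : S y -> quo p S y = 0.
Proof.
move=> Sy; apply/eqP; rewrite eq_le; apply/andP; split.
  by rewrite (le_trans (quo_le _ Sy)) // subrr seminorm0.
by apply: quo_ge => *; exact: seminorm_ge0.
Qed.

Lemma seminorm_quo : seminorm (quo p S).
Proof.
apply: seminormW => [x y|a x]; apply/ler_addgt0Pr => e e0.
  have [x' Sx' hx] := @quo_lt x (e / 2) ltac:(lra).
  have [y' Sy' hy] := @quo_lt y (e / 2) ltac:(lra).
  have Sxy : S (x' + y') by rewrite -[x']scale1r; exact: sS.2.
  apply: le_trans (quo_le _ Sxy) _.
  by rewrite opprD addrACA; apply: le_trans (sp.1 _ _) _; lra.
(* Dividing by [|a| + 1] instead of [|a|] covers [a = 0] as well. *)
have a1 : 0 < `|a| + 1 by rewrite ltr_wpDl.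
have [x' Sx' hx] := @quo_lt x (e / (`|a| + 1)) ltac:(exact: divr_gt0).
have Sa : S (a *: x') by rewrite -[a *: x']addr0; apply: sS.2 => //; exact: sS.1.
apply: le_trans (quo_le _ Sa) _; rewrite -scalerBr sp.2.
apply: le_trans (ler_wpM2l (normr_ge0 a) (ltW hx)) _.
rewrite mulrDr lerD2l mulrCA ler_piMr ?(ltW e0) //.
by rewrite ler_pdivrMr // mul1r lerDl.
Qed.

End Quo.

(* A minimal sublinear functional is linear. *)
Section HahnBanach.

Let sublinear p := (forall x y, p (x + y) <= p x + p y) /\
  (forall (a : R) x, 0 <= a -> p (a *: x) <= a * p x).

Let sublinear0 p : sublinear p -> p 0 = 0.
Proof.
move=> [pD pZ]; apply/eqP; rewrite eq_le; apply/andP; split.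
  by have := pZ 0 0 (lexx _); rewrite scale0r mul0r.
by have := pD 0 0; rewrite addr0; lra.
Qed.

Let sublinearZ p a x : sublinear p -> 0 <= a -> p (a *: x) = a * p x.
Proof.
move=> sp; rewrite le_eqVlt => /predU1P[<-|a0].
  by rewrite scale0r mul0r sublinear0.
apply/eqP; rewrite eq_le sp.2 ?(ltW a0) //=.
have /(ler_wpM2l (ltW a0)) := sp.2 a^-1 (a *: x) ltac:(by rewrite invr_ge0 ltW).
by rewrite scalerA mulVf ?gt_eqF // scale1r mulrA divff ?gt_eqF // mul1r.
Qed.

Let sublinear_ge p x : sublinear p -> - p (- x) <= p x.
Proof. by move=> sp; have := sp.1 x (- x); rewrite subrr sublinear0 //; lra. Qed.

(* A sublinear minorant of p with value [- p z] at [- z]. *)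
Let straighten p z x := inf [set p (x + t *: z) - t * p z | t in [set t | 0 <= t]].

Let straighten_lb p z : sublinear p -> forall x t, 0 <= t ->
  straighten p z x <= p (x + t *: z) - t * p z.
Proof.
move=> sp x t t0; apply: ge_inf; last by exists t.
exists (- p (- x)) => _ [u /= u0 <-].
have := sp.1 (x + u *: z) (- x); rewrite addrAC subrr add0r sublinearZ //; lra.
Qed.

Let straighten_adh p z x e : sublinear p -> 0 < e ->
  exists2 t, 0 <= t & p (x + t *: z) - t * p z < straighten p z x + e.
Proof.
move=> sp e0.
have : has_inf [set p (x + t *: z) - t * p z | t in [set t | 0 <= t]].
  split; first by exists (p (x + 0 *: z) - 0 * p z); exists 0 => /=.
  exists (- p (- x)) => _ [u /= u0 <-].
  have := sp.1 (x + u *: z) (- x); rewrite addrAC subrr add0r sublinearZ //; lra.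
by move=> /(inf_adherent e0)[_ [y Sy <-] ?]; exists y.
Qed.

Let straighten_le p z x : sublinear p -> straighten p z x <= p x.
Proof.
by move=> sp; have := straighten_lb z sp x (lexx 0); rewrite scale0r addr0; lra.
Qed.

Let sublinear_straighten p z : sublinear p -> sublinear (straighten p z).
Proof.
move=> sp; split=> [x y|a x a0]; apply/ler_addgt0Pr => e e0.
  have [t t0 ht] := straighten_adh z x sp (divr_gt0 e0 (ltr0n _ 2)).
  have [u u0 hu] := straighten_adh z y sp (divr_gt0 e0 (ltr0n _ 2)).
  apply: le_trans (straighten_lb z sp _ (addr_ge0 t0 u0)) _.
  have := sp.1 (x + t *: z) (y + u *: z).
  by rewrite addrACA -scalerDl mulrDl; lra.
have a1 : 0 < a + 1 by rewrite ltr_wpDl.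
have [t t0 ht] := straighten_adh z x sp (divr_gt0 e0 a1).
apply: le_trans (straighten_lb z sp _ (mulr_ge0 a0 t0)) _.
rewrite -scalerA -scalerDr sublinearZ // -mulrA -mulrBr.
apply: le_trans (ler_wpM2l a0 (ltW ht)) _.
rewrite mulrDr lerD2l mulrCA ler_piMr ?(ltW e0) //.
by rewrite ler_pdivrMr // mul1r lerDl.
Qed.

(** Zorn's lemma. The infimum of a chain is subadditive because near-minimisers at two different
    vectors can both be replaced by the smaller of the two functionals. *)
Let minimal_sublinear p : sublinear p -> exists q,
  [/\ sublinear q, (forall x, q x <= p x) &
      forall r, sublinear r -> (forall x, r x <= q x) -> forall x, q x <= r x].
Proof.
move=> sp; pose T := {q : V -> R | sublinear q /\ forall x, q x <= p x}.
(* The order is reversed, so that a maximal element is a minimal functional. *)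
pose le (q r : T) := `[< forall x, sval r x <= sval q x >].
have [||A tA|[q [sq qp]] qmax] := @ZL_preorder T (exist _ p (conj sp (fun x => lexx _))) le.
- by move=> t; apply/asboolP.
- move=> r s t /asboolP rs /asboolP st; apply/asboolP => x.
  exact: le_trans (st x) (rs x).
- have [->|/set0P[q0 Aq0]] := eqVneq A set0.
    by exists (exist _ p (conj sp (fun x => lexx _))).
  pose m x := inf [set sval q x | q in A].
  (* Every sublinear minorant of [p] is at least [- p (- x)] at [x], which keeps the infimum
     finite. *)
  have lb x : has_inf [set sval q x | q in A].
    split; first by exists (sval q0 x); exists q0.
    exists (- p (- x)) => _ [[q [sq qp]] _ <-] /=.
    by apply: le_trans (sublinear_ge _ sq); rewrite lerN2.
  have mle x (q : T) : A q -> m x <= sval q x.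
    by move=> Aq; apply: ge_inf; [exact: (lb x).2|exists q].
  have madh x e : 0 < e -> exists2 q, A q & sval q x < m x + e.
    by move=> e0; have [_ [q Aq <-] ?] := inf_adherent e0 (lb x); exists q.
  have sm : sublinear m.
    split=> [x y|a x a0]; apply/ler_addgt0Pr => e e0.
      have [q Aq hq] := madh x (e / 2) (divr_gt0 e0 (ltr0n _ 2)).
      have [r Ar hr] := madh y (e / 2) (divr_gt0 e0 (ltr0n _ 2)).
      have [/asboolP qr|/asboolP rq] := tA _ _ Aq Ar.
        apply: le_trans (mle _ _ Ar) _.
        have := (svalP r).1.1 x y; have := qr x; lra.
      apply: le_trans (mle _ _ Aq) _.
      have := (svalP q).1.1 x y; have := rq y; lra.
    have a1 : 0 < a + 1 by rewrite ltr_wpDl.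
    have [q Aq hq] := madh x _ (divr_gt0 e0 a1).
    apply: le_trans (mle _ _ Aq) _; apply: le_trans ((svalP q).1.2 _ _ a0) _.
    apply: le_trans (ler_wpM2l a0 (ltW hq)) _.
    rewrite mulrDr lerD2l mulrCA ler_piMr ?(ltW e0) //.
    by rewrite ler_pdivrMr // mul1r lerDl.
  have mp x : m x <= p x by apply: le_trans (mle x _ Aq0) ((svalP q0).2 x).
  exists (exist _ m (conj sm mp)) => q Aq; apply/asboolP => x /=; exact: mle.
exists q; split=> // r sr rq x.
have rp y : r y <= p y by exact: le_trans (rq y) (qp y).
have /asboolP := qmax (exist _ r (conj sr rp)) ltac:(by apply/asboolP).
exact.
Qed.

(** Minimising below [straighten p z] instead of [p] forces the value at [- z] down to [- p z],
    hence [f z = p z]. *)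
Theorem hahn_banach p z : seminorm p ->
  exists f : {linear V -> R^o}, (forall x, `|f x| <= p x) /\ f z = p z.
Proof.
move=> sp; have slp : sublinear p.
  by split=> [|a x a0]; [exact: sp.1|rewrite sp.2 ger0_norm].
have [q [sq qp qmin]] := minimal_sublinear (sublinear_straighten z slp).
have qD x y : q (x + y) = q x + q y.
  apply/eqP; rewrite eq_le sq.1 /=.
  (* By minimality, straightening [q] along [y] does not lower it; the parameter [t = 1] then gives
     superadditivity. *)
  have /(_ x) := qmin _ (sublinear_straighten y sq) (straighten_le y ^~ sq).
  have := straighten_lb y sq x ler01; rewrite scale1r mul1r; lra.
have qN x : q (- x) = - q x.
  by have := qD x (- x); rewrite subrr sublinear0 //; lra.
have qZ a x : q (a *: x) = a * q x.
  have [a0|a0] := leP 0 a; first exact: sublinearZ.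
  have /(sublinearZ x sq) : 0 <= - a by rewrite oppr_ge0 ltW.
  by rewrite scaleNr qN mulNr => /oppr_inj.
have qlin : linear (q : V -> R^o) by move=> a x y; rewrite qD qZ.
pose f : {linear V -> R^o} := HB.pack (q : V -> R^o)
  (GRing.isLinear.Build _ _ _ _ q qlin).
have qle x : q x <= p x := le_trans (qp x) (straighten_le z x slp).
exists f; split=> [x|].
  rewrite ler_norml qle andbT lerNl -[- f x]qN.
  by rewrite -(seminormN x sp); exact: qle.
apply/eqP; rewrite eq_le qle /=.
have := straighten_lb z slp (- z) ler01.
rewrite scale1r addNr (seminorm0 sp) mul1r => /(le_trans (qp _)).
by rewrite qN sub0r lerN2.
Qed.

End HahnBanach.
End Seminorms.

(** * Spans and Riesz's lemma *)

Lemma lipschitz_continuous {R : realType} {U W : normedModType R} (f : U -> W)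
    (L : R) : (forall x y, `|f x - f y| <= L * `|x - y|) -> continuous f.
Proof.
move=> fL x; apply/cvgrPdist_lt => e e0.
have L1 : 0 < `|L| + 1 by rewrite ltr_wpDl.
near=> y; apply: le_lt_trans (fL _ _) _.
have : `|x - y| < e / (`|L| + 1).
  by near: y; apply: cvgr_dist_lt => //; exact: divr_gt0.
rewrite ltr_pdivlMr // mulrDr mulr1 => h.
have := ler_wpM2r (normr_ge0 (x - y)) (ler_norm L).
have := normr_ge0 (x - y); rewrite [`|L| * _]mulrC; lra.
Unshelve. all: by end_near. Qed.

(** Dependent choice in which each term may depend on the whole list of its predecessors. *)
Lemma seq_choice (T : Type) (P : seq T -> T -> Prop) :
  (forall s, exists x, P s x) -> exists f : nat -> T, forall n, P (mkseq f n) (f n).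
Proof.
move=> /choice[g Pg]; pose l := fix l n := if n is m.+1 then rcons (l m) (g (l m)) else [::].
exists (fun n => g (l n)) => n.
suff -> : mkseq (fun n => g (l n)) n = l n by exact: Pg.
by elim: n => //= n IH; rewrite mkseqS IH.
Qed.

Section Spans.
Context {R : realType} {Y : normedModType R}.

Lemma seminorm_norm : seminorm (fun x : Y => `|x|).
Proof. by split=> [x y|a x]; [exact: ler_normD|exact: normrZ]. Qed.

(** Peeling off one vector at a time suits the induction in [span_quo_gt0]. *)
Fixpoint span (s : seq Y) : set Y :=
  if s is a :: s' then [set y | exists c : R, span s' (y - c *: a)] else [set 0].

Lemma subsp_span s : subsp (span s).
Proof.
elim: s => [|a s [S0 SD]]; split=> //=.
- by move=> c x y -> ->; rewrite scaler0 addr0.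
- by exists 0; rewrite scale0r subr0.
- move=> c x y [d xd] [e ye]; exists (c * d + e).
  have -> : c *: x + y - (c * d + e) *: a = c *: (x - d *: a) + (y - e *: a).
    by rewrite scalerDl scalerBr -scalerA addrACA opprD.
  exact: SD.
Qed.

Lemma span_cons a s x : span s x -> span (a :: s) x.
Proof. by move=> sx; exists 0; rewrite scale0r subr0. Qed.

Lemma mem_span s x : x \in s -> span s x.
Proof.
elim: s => // a s IH; rewrite inE => /orP[/eqP ->|/IH]; last exact: span_cons.
by exists 1; rewrite scale1r subrr; exact: (subsp_span s).1.
Qed.

Lemma span_sum s x : span s x ->
  exists c : 'I_(size s) -> R, x = \sum_(i < size s) c i *: nth 0 s i.
Proof.
elim: s x => [|a s IH] x /=.
  by move=> ->; exists (fun=> 0); rewrite big_ord0.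
move=> [c0 /IH[c xc]].
exists (fun i => if unlift ord0 i is Some j then c j else c0).
rewrite big_ord_recl unlift_none /=.
under eq_bigr do rewrite liftK /=.
by rewrite -xc addrC subrK.
Qed.

Lemma infinite_dim_span s : ~ finite_dimensional Y -> exists z, ~ span s z.
Proof.
move=> infY; apply: contrapT => /forallNP h; apply: infY.
exists (size s), (fun i => nth 0 s i) => x.
by apply: span_sum; apply: contrapT; exact: h.
Qed.

(** Finite-dimensional subspaces are closed. In the induction, the distance from [z - c *: a] to
    [span s] is continuous in [c] and only a compact interval of [c] matters, so a zero infimum
    would be attained. *)
Lemma span_quo_gt0 s z : ~ span s z -> 0 < quo (fun x => `|x|) (span s) z.
Proof.
elim: s z => [|a s IH] z nz.
  have : 0 < `|z| by rewrite normr_gt0; apply/eqP.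
  move=> /lt_le_trans; apply; apply: quo_ge => [|y ->]; last by rewrite subr0.
  exact: (subsp_span [::]).
have sN := seminorm_norm; have ssp := subsp_span s; have ssp' := subsp_span (a :: s).
have nzc c : ~ span s (z - c *: a) by move=> h; apply: nz; exists c.
set q := quo _ (span s) in IH; have sq : seminorm q by exact: seminorm_quo.
(* If [a] already lies in [span s], the span does not grow. *)
have [sa|nsa] := pselect (span s a).
  apply: lt_le_trans (IH z _) _; first by have := nzc 0; rewrite scale0r subr0.
  apply: quo_ge => // y [c yc]; apply: quo_le => //.
  by rewrite -[y](subrK (c *: a)) addrC; apply: ssp.2.
have qa := IH _ nsa.
rewrite lt_neqAle seminorm_ge0 ?andbT; last exact: seminorm_quo.
apply/negP => /eqP q0.
pose f c := q (z - c *: a).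
have small e : 0 < e -> exists2 c, `|c| <= (e + q z) / q a & f c < e.
  move=> e0; have [y [c yc]] := quo_lt sN ssp' z e0; rewrite -q0 add0r => ye.
  have fe : f c < e.
    apply: le_lt_trans ye; rewrite /f.
    have -> : z - y = z - c *: a - (y - c *: a) by rewrite opprB addrA subrK.
    exact: quo_le.
  exists c => //; rewrite ler_pdivlMr // -sq.2.
  by have := seminorm_leB (c *: a) z sq; rewrite seminormBC // -/(f c); lra.
pose B := (1 + q z) / q a.
have B0 : 0 <= B by rewrite divr_ge0 ?(ltW qa) // addr_ge0 // seminorm_ge0.
have fL c d : `|f c - f d| <= q a * `|c - d|.
  apply: le_trans (seminorm_distB _ _ sq) _.
  have -> : z - c *: a - (z - d *: a) = (d - c) *: a.
    by rewrite opprB addrC addrA subrK scalerBl.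
  by rewrite sq.2 mulrC distrC.
have fc : continuous (f : R^o -> R^o) := lipschitz_continuous fL.
have [c cB cmin] := @EVT_min R f (- B) B ltac:(lra) (continuous_subspaceT fc).
suff : f c <= 0.
  move=> fc0; have := IH _ (nzc c); rewrite -/(f c); lra.
apply/ler_addgt0Pr => e e0; rewrite add0r.
(* Capping [e] at 1 keeps [d] inside the interval [[- B, B]] of minimisation. *)
have [d dB de] := @small (Num.min e 1) ltac:(by rewrite lt_min e0 ltr01).
apply: le_trans (cmin d _) _; last by apply: ltW (lt_le_trans de _); rewrite ge_min lexx.
rewrite in_itv /= -ler_norml; apply: le_trans dB _.
by rewrite ler_pM2r ?invr_gt0 // lerD2r ge_min lexx orbT.
Qed.

(** Hahn-Banach for the distance to the span yields a functional that kills the span and has norm at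
    most 1; it is almost attained in the direction from an almost nearest point [y] to [z]. *)
Lemma riesz (s : seq Y) (tau : R) : ~ finite_dimensional Y -> 0 < tau ->
  exists (e : Y) (chi : {linear Y -> R^o}),
  [/\ `|e| = 1, forall x, `|chi x| <= `|x|, forall y, span s y -> chi y = 0
    & 1 - tau <= chi e].
Proof.
move=> infY tau0; have [z nz] := infinite_dim_span s infY.
have sN := seminorm_norm; have ss := subsp_span s.
have d0 := span_quo_gt0 nz; set q := quo _ (span s) in d0.
have sq : seminorm q by exact: seminorm_quo.
have [chi [chiq chiz]] := hahn_banach z sq.
have [y sy zy] := quo_lt sN ss z (mulr_gt0 d0 tau0); rewrite -/q in zy.
have chi0 x : span s x -> chi x = 0.
  move=> sx; apply/eqP; rewrite -normr_le0; apply: le_trans (chiq _) _.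
  by rewrite /q quo_eq0.
have qN x : q x <= `|x| by exact: quo_le_id.
have w0 : 0 < `|z - y| by apply: lt_le_trans d0 _; exact: quo_le.
exists (`|z - y|^-1 *: (z - y)), chi; split => //.
- by rewrite normrZ normfV normr_id mulVf ?gt_eqF.
- by move=> x; exact: le_trans (chiq x) (qN x).
- rewrite linearZ linearB /= chiz (chi0 y) // subr0 /GRing.scale /= mulrC.
  rewrite ler_pdivlMr //.
  (* For [tau >= 1] the left side is nonpositive; otherwise [(1 - tau) * (1 + tau) <= 1]
     suffices. *)
  have [t1|t1] := leP 1 tau.
    have : (1 - tau) * `|z - y| <= 0 by rewrite mulr_le0_ge0 ?subr_le0.
    by move: d0; lra.
  have t1' : 0 <= 1 - tau by lra.
  have /(ler_wpM2l t1')/le_trans := ltW zy; apply.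
  have := mulr_ge0 (ltW d0) (sqr_ge0 tau); lra.
Qed.

End Spans.

(** The image of [U] under [u] is an ultrafilter containing the compact interval [[- B, B]]. *)
Lemma ultra_lim {R : realType} (U : set_system nat) (u : nat -> R) (B : R) :
  UltraFilter U -> (forall n, `|u n| <= B) -> exists2 l, `|l| <= B & u @ U --> l.
Proof.
move=> UU uB; have UV : UltraFilter (u @ U).
  split=> [|G PG UG]; first exact: fmap_proper_filter.
  apply/seteqP; split => A GA; last exact: UG.
  have [//|UnA] := in_ultra_setVsetC (u @^-1` A) UU.
  have GnA : G (~` A) by exact: UG.
  case: (@filter_not_empty _ G PG); rewrite -(setICr A); exact: filterI.
have := @segment_compact R (- B) B; rewrite compact_ultra => /(_ _ UV)[|l [lB ul]].
  rewrite /nbhs /=; apply: filterS filterT => n _ /=.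
  by rewrite in_itv /= -ler_norml.
by exists l => //; move: lB; rewrite /= in_itv /= -ler_norml.
Qed.

(** * Kink functionals *)

Lemma ultra_forall (U : set_system nat) (P : nat -> set nat) n : UltraFilter U ->
  (forall k, (k < n)%N -> U (P k)) -> U [set i | forall k, (k < n)%N -> P k i].
Proof.
move=> UU; elim: n => [|n IH] h; first by apply: filterS filterT.
have Un := h n (ltnSn n).
have /IH IHn : forall k, (k < n)%N -> U (P k) by move=> k kn; apply: h; exact: ltnW.
apply: filterS (filterI Un IHn) => i [Pn Pk] k.
by rewrite ltnS leq_eqVlt => /predU1P[->|/Pk].
Qed.

Section System.
Context {R : realType} {Y : normedModType R}.

Lemma lincomb (f g : {linear Y -> R^o}) (a : R) :
  exists h : {linear Y -> R^o}, forall x, h x = f x + a * g x.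
Proof. by exists (f \+ a \*: g). Qed.

(* Write Lam f for the limit of [f (e n)] along [U], an element of the bidual.
   If |Lam (chi b)| >= 1/2 for arbitrarily large b, subtracting a multiple of such
   a [chi b] makes Lam psi = 0; otherwise |Lam (chi i)| < 1/2 for large i, which
   leaves enough room for [kappa * |psi|]. *)
Lemma tilt_functional (e : nat -> Y) (chi : nat -> {linear Y -> R^o})
    (U : set_system nat) (kappa : R) :
  UltraFilter U -> (forall N, U [set i | (N <= i)%N]) ->
  (forall i, `|e i| = 1) -> (forall i x, `|chi i x| <= `|x|) ->
  (forall i, 7 / 8 <= chi i (e i)) -> (forall i j, (i < j)%N -> chi j (e i) = 0) ->
  0 <= kappa -> 12 * kappa <= 1 ->
  exists m0, forall i (g : {linear Y -> R^o}) (th : R), (m0 <= i)%N ->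
    (forall x, `|g x| <= `|x|) -> 0 <= th <= 10^-1 ->
  exists psi : {linear Y -> R^o},
  [/\ forall x, `|psi x| <= 6 * `|x|, psi (e i) = 0, 1 / 2 <= psi (e i.+1),
      forall x, (forall j, (i <= j)%N -> chi j x = 0) -> psi x = th * g x
    & forall t, 0 < t ->
        U [set n | `|chi i (e n)| + kappa * `|psi (e n)| <= 1 + t]].
Proof.
move=> UU Uoo e1 chiN chie chi0 k0 k12.
have lim (f : {linear Y -> R^o}) B : (forall x, `|f x| <= B * `|x|) ->
    exists2 l, `|l| <= B & f (e n) @[n --> U] --> l.
  by move=> fB; apply: ultra_lim => n; have := fB (e n); rewrite e1 mulr1.
have /choice[al alP] : forall b, exists l, `|l| <= 1 /\ chi b (e n) @[n --> U] --> l.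
  move=> b; have [l l1 lb] := lim (chi b) 1 ltac:(by move=> x; rewrite mul1r).
  by exists l.
(* The candidate is [chi i.+1 + th * (g - r * chi i)]: [r] makes it vanish at [e i], and [chi i.+1],
   which is zero there, provides the value at [e i.+1], since 7/8 - 3/10 exceeds 1/2. *)
have main i (g : {linear Y -> R^o}) th : (forall x, `|g x| <= `|x|) -> 0 <= th <= 10^-1 ->
  exists psi : {linear Y -> R^o},
  [/\ forall x, `|psi x| <= 2 * `|x|, psi (e i) = 0, 1 / 2 <= psi (e i.+1) &
      forall x, (forall j, (i <= j)%N -> chi j x = 0) -> psi x = th * g x].
  move=> gN /andP[th0 th1].
  have ci : 0 < chi i (e i) by apply: lt_le_trans (chie i); lra.
  pose r : R := g (e i) / chi i (e i).
  have r2 : `|r| <= 2.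
    rewrite normrM normfV (ger0_norm (ltW ci)) ler_pdivrMr //.
    by have := gN (e i); have := chie i; rewrite e1; lra.
  have [f1 f1E] := lincomb (chi i.+1) g th.
  have [f fE0] := lincomb f1 (chi i) (- (th * r)).
  have fE x : f x = chi i.+1 x + th * (g x - r * chi i x).
    by rewrite fE0 f1E; ring.
  have gr x : `|g x - r * chi i x| <= 3 * `|x|.
    apply: le_trans (ler_normB _ _) _; rewrite normrM.
    have := ler_pM (normr_ge0 _) (normr_ge0 _) r2 (chiN i x).
    by have := gN x; lra.
  have thgr x : `|th * (g x - r * chi i x)| <= 3 / 10 * `|x|.
    rewrite normrM ger0_norm //.
    have := ler_pM th0 (normr_ge0 _) th1 (gr x); lra.
  exists f; split.
  - move=> x; rewrite fE; apply: le_trans (ler_normD _ _) _.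
    by have := chiN i.+1 x; have := thgr x; have := normr_ge0 x; lra.
  - by rewrite fE chi0 // /r mulfVK ?gt_eqF // subrr mulr0 addr0.
  - rewrite fE; have := thgr (e i.+1); rewrite e1 mulr1 ler_norml.
    by have := chie i.+1; move=> ? /andP[]; lra.
  - by move=> x h; rewrite fE !h // mulr0 subr0 add0r.
have dist (f : {linear Y -> R^o}) l t : f (e n) @[n --> U] --> l -> 0 < t ->
    U [set n | `|f (e n)| <= `|l| + t].
  move=> fl t0; have Ut : U [set n | `|l - f (e n)| <= t].
    by move/cvgrPdist_le : fl => /(_ _ t0).
  apply: filterS Ut => n /= h.
  by rewrite distrC in h; have := lerB_dist (f (e n)) l; lra.
have [H|H] := pselect (forall m, exists b, (m <= b)%N /\ 1 / 2 <= `|al b|).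
  exists 0%N => i g th _ gN th01.
  have [f [fN fe fe1 fth]] := main i g th gN th01.
  have [l l2 fl] := lim f 2 fN.
  (* Since [b >= i + 2], [chi b] vanishes at [e i] and [e i.+1], so subtracting [s * chi b]
     preserves both values. The norm becomes at most 2 + 4 = 6. *)
  have [b [ib alb]] := H i.+2.
  have albN : al b != 0 by rewrite -normr_gt0; lra.
  pose s := l / al b.
  have s4 : `|s| <= 4.
    rewrite normrM normfV ler_pdivrMr ?normr_gt0 //; lra.
  have [psi psiE] := lincomb f (chi b) (- s).
  exists psi; split.
  - move=> x; rewrite psiE mulNr; apply: le_trans (ler_normB _ _) _; rewrite normrM.
    by have := ler_pM (normr_ge0 _) (normr_ge0 _) s4 (chiN b x); have := fN x; lra.
  - by rewrite psiE fe chi0 ?mulr0 ?addr0 // (leq_trans _ ib).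
  - by rewrite psiE chi0 ?mulr0 ?addr0.
  - by move=> x h; rewrite psiE fth // h ?mulr0 ?addr0 // (leq_trans _ ib) // ltnW.
  - move=> t t0.
    have psi0 : psi (e n) @[n --> U] --> (0 : R).
      have -> : (0 : R) = l + - s * al b by rewrite mulNr /s mulfVK // subrr.
      under eq_fun do rewrite psiE.
      by apply: cvgD => //; apply: cvgM; [exact: cvg_cst|exact: (alP b).2].
    have t2 : 0 < t / 2 by lra.
    apply: filterS (filterI (dist _ _ _ (alP i).2 t2) (dist _ _ _ psi0 t2)) => n /= [].
    rewrite normr0 add0r => h1 h2; have := (alP i).1.
    by have := ler_wpM2l k0 h2; have := ler_wpM2r (ltW t2) k12; nra.
have [m0 alt] : exists m, forall b, (m <= b)%N -> `|al b| < 1 / 2.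
  move/existsNP: H => [m /forallNP Hm]; exists m => b mb.
  by rewrite ltNge; apply/negP => h; apply: (Hm b).
exists m0 => i g th m0i gN th01.
(* Here no correction is made: [|chi i (e n)|] is eventually at most [1/2 + t] along [U], and
   [kappa * |f (e n)| <= 2 * kappa <= 1/6]. *)
have [f [fN fe fe1 fth]] := main i g th gN th01.
exists f; split => //; first by move=> x; have := fN x; have := normr_ge0 x; lra.
move=> t t0; apply: filterS (dist _ _ _ (alP i).2 t0) => n /= h.
have := alt _ m0i; have := fN (e n); rewrite e1 => h1 h2.
have := ler_wpM2l k0 h1; lra.
Qed.

(* By [ts_lt] and [ts_gt], near [E n] the seminorm [|chi n| + kappa * |psi n|]
   strictly dominates the others, once these are given increasing weights. *)
Record tilted_system (v : nat -> Y) (kappa : R) (tau : nat -> R)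
    (E W : nat -> Y) (chi psi g : nat -> {linear Y -> R^o}) : Prop := {
  ts_E1 : forall n, `|E n| = 1;
  ts_W1 : forall n, `|W n| = 1;
  ts_chi : forall n x, `|chi n x| <= `|x|;
  ts_psi : forall n x, `|psi n x| <= 6 * `|x|;
  ts_chiE : forall n, 1 - tau n <= chi n (E n);
  ts_psiE : forall n, psi n (E n) = 0;
  ts_psiW : forall n, 1 / 2 <= psi n (W n);
  ts_lt : forall m n, (m < n)%N -> `|chi m (E n)| + kappa * `|psi m (E n)| <= 1 + tau n;
  ts_gt : forall m n, (n < m)%N -> chi m (E n) = 0 /\ `|psi m (E n)| <= 1;
  ts_g : forall j x, `|g j x| <= `|x|;
  ts_sep : forall z, z != 0 -> exists j, g j z != 0;
  ts_flat : forall j m k, exists n, forall i, (i <= k)%N ->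
    chi n (v i) = 0 /\ psi n (v i) = (m + 10)%:R^-1 * g j (v i) }.

(** Riesz's lemma gives a raw sequence [e], [chi]; a subsequence is then chosen step by step. Each
    condition relating a new vector to the finitely many earlier functionals holds on a set of [U],
    so all can be met at once. *)
Lemma tilted_system_exists (v : nat -> Y) (kappa : R) (tau : nat -> R) :
  ~ finite_dimensional Y -> (forall x d, 0 < d -> exists i, `|x - v i| < d) ->
  0 <= kappa -> 12 * kappa <= 1 ->
  (forall n, 0 < tau n <= 8^-1) -> (forall m n, (m <= n)%N -> tau n <= tau m) ->
  exists E W chi psi g, tilted_system v kappa tau E W chi psi g.
Proof.
move=> infY dv k0 k12 tau0 tauD.
have /choice[g gP] : forall j, exists f : {linear Y -> R^o},
    (forall x, `|f x| <= `|x|) /\ f (v j) = `|v j|.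
  by move=> j; exact: hahn_banach (v j) seminorm_norm.
have [ec ecP] : exists ec : nat -> Y * {linear Y -> R^o}, forall n,
  [/\ `|(ec n).1| = 1, forall x, `|(ec n).2 x| <= `|x|,
      forall y, span (mkseq v n.+1 ++ mkseq (fst \o ec) n) y -> (ec n).2 y = 0
    & 1 - tau n <= (ec n).2 (ec n).1].
  have [|ec ecP] := @seq_choice (Y * {linear Y -> R^o}) (fun s x =>
    [/\ `|x.1| = 1, forall y, `|x.2 y| <= `|y|,
      forall y, span (mkseq v (size s).+1 ++ map fst s) y -> x.2 y = 0
    & 1 - tau (size s) <= x.2 x.1]).
    move=> s; have [|e [chi]] := riesz (mkseq v (size s).+1 ++ map fst s) infY (_ : 0 < tau (size s)).
      by case/andP: (tau0 (size s)).
    by exists (e, chi).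
  exists ec => n; have := ecP n; rewrite size_mkseq.
  by rewrite (_ : map fst (mkseq ec n) = mkseq (fst \o ec) n) // /mkseq -map_comp.
pose e i := (ec i).1; pose chi i := (ec i).2.
have e1 i : `|e i| = 1 by have [] := ecP i.
have chiN i x : `|chi i x| <= `|x| by have [_ + _ _] := ecP i; exact.
have chiE i : 1 - tau i <= chi i (e i) by have [_ _ _] := ecP i.
have chi78 i : 7 / 8 <= chi i (e i).
  by have := chiE i; have /andP[_] := tau0 i; lra.
have chiv i j : (i <= j)%N -> chi j (v i) = 0.
  move=> ij; have [_ _ h _] := ecP j; apply: h; apply: mem_span.
  by rewrite mem_cat; apply/orP; left; apply/mapP; exists i; rewrite ?mem_iota.
have chie i j : (i < j)%N -> chi j (e i) = 0.
  move=> ij; have [_ _ h _] := ecP j; apply: h; apply: mem_span.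
  by rewrite mem_cat; apply/orP; right; apply/mapP; exists i; rewrite ?mem_iota.
have [U [UU Uoo]] := ultraFilterLemma (eventually_filter : ProperFilter \oo).
have {}Uoo N : U [set i | (N <= i)%N] by apply: Uoo; exists N.
have [m0 tilt] := tilt_functional UU Uoo e1 chiN chi78 chie k0 k12.
pose T := (nat * {linear Y -> R^o})%type.
(* Step [n] handles the triple [(j, m, k)] coded by [n]: the functional [g j], the factor
   [1 / (m + 10)] and the points [v i] with [i <= k]. Every triple thus gets its turn. *)
pose lab (n : nat) : nat * nat * nat := odflt (0, 0, 0)%N (unpickle n).
pose good (y : T) := forall t, 0 < t ->
  U [set n | `|chi y.1 (e n)| + kappa * `|y.2 (e n)| <= 1 + t].
pose base n (x : T) :=
  [/\ (n <= x.1)%N, ((lab n).2 <= x.1)%N, good x, forall y, `|x.2 y| <= 6 * `|y| &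
  [/\ x.2 (e x.1) = 0, 1 / 2 <= x.2 (e x.1.+1) &
     forall y, (forall j, (x.1 <= j)%N -> chi j y = 0) ->
      x.2 y = ((lab n).1.2 + 10)%:R^-1 * g (lab n).1.1 y]].
pose x0 : T := (0%N, chi 0%N).
(* [seq_choice] ranges over arbitrary lists, so goodness of the earlier terms is a premise; it is
   discharged afterwards by strong induction. *)
have [s0|f fP] := @seq_choice T (fun s x =>
    (forall k, (k < size s)%N -> good (nth x0 s k)) ->
    base (size s) x /\ forall k, (k < size s)%N ->
      ((nth x0 s k).1 < x.1)%N /\
      `|chi (nth x0 s k).1 (e x.1)| + kappa * `|(nth x0 s k).2 (e x.1)| <= 1 + tau (size s)).
  have [gs|] := pselect (forall k, (k < size s0)%N -> good (nth x0 s0 k)); last first.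
    by move=> ngs; exists x0.
  set n := size s0.
  have tn : 0 < tau n by case/andP: (tau0 n).
  have Us : U [set i | forall k, (k < n)%N -> ((nth x0 s0 k).1 < i)%N /\
      `|chi (nth x0 s0 k).1 (e i)| + kappa * `|(nth x0 s0 k).2 (e i)| <= 1 + tau n].
    apply: (ultra_forall (P := fun k => [set i | ((nth x0 s0 k).1 < i)%N] `&`
      [set i | `|chi (nth x0 s0 k).1 (e i)| + kappa * `|(nth x0 s0 k).2 (e i)| <= 1 + tau n])).
    by move=> k kn; apply: filterI; [exact: Uoo|exact: gs].
  have Ui : U ([set i | (maxn n (maxn (lab n).2 m0) <= i)%N] `&`
      [set i | forall k, (k < n)%N -> ((nth x0 s0 k).1 < i)%N /\
      `|chi (nth x0 s0 k).1 (e i)| + kappa * `|(nth x0 s0 k).2 (e i)| <= 1 + tau n]).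
    by apply: filterI => //; exact: Uoo.
  have [i [/= + si]] := filter_ex Ui.
  rewrite !geq_max => /and3P[ni li m0i].
  pose th : R := ((lab n).1.2 + 10)%:R^-1.
  have th01 : 0 <= th <= 10^-1.
    apply/andP; split; first by rewrite invr_ge0 ler0n.
    by rewrite lef_pV2 ?posrE ?ltr0n ?addn_gt0 ?orbT // ler_nat leq_addl.
  have [psi [psiN psie psie1 psiv psiU]] := tilt i _ _ m0i (gP (lab n).1.1).1 th01.
  exists (i, psi) => _; split; first by split.
  by move=> k kn; have [] := si k kn.
have {}fP n : base n (f n) /\ forall k, (k < n)%N -> ((f k).1 < (f n).1)%N /\
      `|chi (f k).1 (e (f n).1)| + kappa * `|(f k).2 (e (f n).1)| <= 1 + tau n.
  elim/ltn_ind: n => n IH; have := fP n; rewrite size_mkseq => /(_ _)[].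
    by move=> k kn; rewrite nth_mkseq //; have [[]] := IH k kn.
  by move=> b h; split=> // k kn; have := h k kn; rewrite nth_mkseq.
exists (fun n => e (f n).1), (fun n => e (f n).1.+1), (fun n => chi (f n).1).
exists (fun n => (f n).2), g; split => //.
- by move=> n x; have [[_ _ _ + _] _] := fP n; exact.
- move=> n; have [[+ _ _ _ _] _] := fP n => /tauD; have := chiE (f n).1; lra.
- by move=> n; have [[_ _ _ _ [? ? _]] _] := fP n.
- by move=> n; have [[_ _ _ _ [? ? _]] _] := fP n.
- by move=> m n mn; have [_ /(_ _ mn)[]] := fP n.
- move=> m n nm; have [[_ _ _ _ [_ _ fm]] /(_ _ nm)[h _]] := fP m.
  split; first exact: chie.
  (* All [chi j] from the index of step [m] on vanish at [E n], so [psi m] is there a multiple of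
     some [g j] by a factor at most 1. *)
  rewrite fm; last by move=> j mj; apply: chie; exact: leq_trans mj.
  rewrite normrM normfV normr_nat; apply: mulr_ile1 => //.
    by rewrite invf_le1 ?ler1n ?ltr0n addn_gt0 orbT.
  by rewrite -(e1 (f n).1); exact: (gP _).1.
- by move=> j; exact: (gP j).1.
- move=> z z0; have zz : 0 < `|z| by rewrite normr_gt0.
  have [j zj] := dv z (`|z| / 3) ltac:(by rewrite divr_gt0).
  (* Otherwise [|v j| = g j (v j - z)] is less than a third of [|z|], too small for a point that
     close to [z]. *)
  exists j; apply/eqP => gz.
  have h1 : g j (v j - z) = `|v j| by rewrite linearB /= gz subr0 (gP j).2.
  have := (gP j).1 (v j - z); rewrite h1 normr_id distrC => h2.
  have := lerB_dist z (v j); lra.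
- move=> j m k; exists (pickle (j, m, k)) => i ik.
  have [[_ + _ _ [_ _ +]] _] := fP (pickle (j, m, k)).
  rewrite /lab choice.pickleK /= => kf h; split.
    by apply: chiv; exact: leq_trans kf.
  by apply: h => l hl; apply: chiv; apply: leq_trans hl; exact: leq_trans kf.
Qed.

End System.

(** * The renorming *)

Section Renorming.
Context {R : realType} {Y : normedModType R} (v : nat -> Y) (h : R)
  (E W : nat -> Y) (chi psi g : nat -> {linear Y -> R^o}).

(** One sequence serves twice: it makes the weights [1 + h - gap n] increase, and it gives the
    summable coefficients of the squares of the [q i]. *)
Definition gap n : R := h / 2 ^+ n.+1.
Definition tau n : R := gap n / 8.
Definition kappa : R := h / 12.

Hypotheses (h0 : 0 < h) (h1 : h <= 1)
  (ts : tilted_system v kappa tau E W chi psi g)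
  (dv : forall x d, 0 < d -> exists i, `|x - v i| < d).

Ltac lrah := have := h0; have := h1; lra.

Let cst n : R := 1 + h - gap n.
Let kink n x : R := cst n * (`|chi n x| + kappa * `|psi n x|).
Let face n x : R := cst n * `|chi n x|.
Let kinky x := Num.max `|x| (supn kink x).
Let flat x := Num.max `|x| (supn face x).
Let q i := quo flat (span [:: v i]).

(** Nesting [hypot] makes the seminorm property a plain induction; [partialn_sqr] recovers the sum
    of squares. *)
Let partialn := fix P J := if J is J'.+1 then
  hypot (P J') (fun x => Num.sqrt (gap J') * q J' x) else kinky.

(* [renorm x] is the square root of [kinky x ^+ 2 + \sum_i gap i * q i x ^+ 2],
   written as the supremum over the partial sums of the series. *)
Definition renorm x := supn partialn x.

Lemma gap_gt0 n : 0 < gap n.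
Proof. by rewrite divr_gt0 // exprn_gt0. Qed.

Let gapS n : gap n.+1 = gap n / 2.
Proof. by rewrite /gap exprS invfM mulrCA mulrC. Qed.

Lemma gap_lt m n : (m < n)%N -> 2 * gap n <= gap m.
Proof.
move=> /subnK <-; elim: (n - m.+1)%N => [|k IH]; first by rewrite add0n gapS; lra.
by rewrite addSn gapS; have := gap_gt0 (k + m.+1); lra.
Qed.

Let gap_le n : 2 * gap n <= h.
Proof.
elim: n => [|n IH]; last by rewrite gapS; have := gap_gt0 n; lra.
by rewrite /gap expr1; lra.
Qed.

Let sqr4 : (1 + h) ^+ 2 <= 4.
Proof.
have -> : 4 = 2 ^+ 2 :> R by ring.
by rewrite ler_pXn2r ?nnegrE //; lrah.
Qed.

Let cst_bnd n : 1 <= cst n <= 2.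
Proof. by have := gap_gt0 n; have := gap_le n; rewrite /cst; lrah. Qed.

Let kappa0 : 0 <= kappa. Proof. by rewrite /kappa; lrah. Qed.

Let chiN n x := ts_chi ts n x.
Let psiN n x := ts_psi ts n x.

Let seminorm_kink n : seminorm (kink n).
Proof.
have /andP[c1 _] := cst_bnd n; apply: seminormM; first by lra.
apply: seminormD; first exact: seminorm_lin.
by apply: seminormM => //; exact: seminorm_lin.
Qed.

Let seminorm_face n : seminorm (face n).
Proof.
have /andP[c1 _] := cst_bnd n; apply: seminormM; first by lra.
exact: seminorm_lin.
Qed.

Let face_kink n x : face n x <= kink n x.
Proof.
have /andP[c1 _] := cst_bnd n; apply: ler_wpM2l; first by lra.
by rewrite lerDl mulr_ge0 // kappa0.
Qed.

Let kink_le n x : kink n x <= (1 + h) ^+ 2 * `|x|.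
Proof.
have /andP[c1 _] := cst_bnd n; have := gap_gt0 n => g0.
rewrite expr2 -mulrA; apply: ler_pM; [lra|by rewrite addr_ge0 // mulr_ge0 // kappa0|by rewrite /cst; lra|].
have := ler_wpM2l kappa0 (psiN n x); rewrite /kappa.
have := mulr_ge0 (ltW h0) (normr_ge0 x); have := chiN n x; lra.
Qed.

Let kink_bounded : pbounded kink.
Proof. by move=> x; exists ((1 + h) ^+ 2 * `|x|) => n; exact: kink_le. Qed.

Let face_bounded : pbounded face.
Proof.
by move=> x; exists ((1 + h) ^+ 2 * `|x|) => n; exact: le_trans (face_kink _ _) (kink_le _ _).
Qed.

Let seminorm_kinky : seminorm kinky.
Proof. exact: seminorm_max seminorm_norm (seminorm_supn kink_bounded seminorm_kink). Qed.

Let seminorm_flat : seminorm flat.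
Proof. exact: seminorm_max seminorm_norm (seminorm_supn face_bounded seminorm_face). Qed.

Let flat_kinky x : flat x <= kinky x.
Proof.
rewrite /flat /kinky ge_max !le_max lexx /=; apply/orP; right.
apply: supn_le => n; apply: le_trans (face_kink n x) _; exact: supn_ge.
Qed.

Let kinky_le x : kinky x <= (1 + h) ^+ 2 * `|x|.
Proof.
rewrite /kinky ge_max; apply/andP; split; last by apply: supn_le => n; exact: kink_le.
by rewrite ler_peMl // expr_ge1 //; lrah.
Qed.

Let norm_flat x : `|x| <= flat x. Proof. by rewrite le_max lexx. Qed.

Let subl i : subsp (span [:: v i]) := subsp_span [:: v i].

Let seminorm_q i : seminorm (q i). Proof. exact: seminorm_quo. Qed.

Let q_le i x : q i x <= flat x. Proof. exact: quo_le_id. Qed.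

Let q_ge0 i x : 0 <= q i x. Proof. exact: seminorm_ge0. Qed.

Let kinky_ge0 x : 0 <= kinky x. Proof. exact: seminorm_ge0. Qed.

Let seminorm_partialn J : seminorm (partialn J).
Proof.
by elim: J => //= J IH; apply: seminorm_hypot => //; exact: seminormM (sqrtr_ge0 _) _.
Qed.

Let partialn_ge0 J x : 0 <= partialn J x. Proof. exact: seminorm_ge0. Qed.

Let partialn_sqr J x :
  partialn J x ^+ 2 = kinky x ^+ 2 + \sum_(i < J) gap i * q i x ^+ 2.
Proof.
elim: J => [|J IH]; first by rewrite big_ord0 addr0.
by rewrite big_ord_recr /= hypot_sqr IH exprMn sqr_sqrtr ?(ltW (gap_gt0 _)) // addrA.
Qed.

Let sum_gap J : \sum_(i < J) gap i = h - 2 * gap J.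
Proof.
elim: J => [|J IH]; first by rewrite big_ord0 /gap expr1; lra.
by rewrite big_ord_recr /= IH gapS; lra.
Qed.

Let partialn_le J x : partialn J x <= (1 + h) * kinky x.
Proof.
have k0 := kinky_ge0 x.
rewrite -(@ler_pXn2r _ 2) ?nnegrE ?mulr_ge0 //; last lrah.
rewrite partialn_sqr exprMn.
have : \sum_(i < J) gap i * q i x ^+ 2 <= \sum_(i < J) gap i * kinky x ^+ 2.
  apply: ler_sum => i _; apply: ler_wpM2l; first exact: ltW (gap_gt0 _).
  by rewrite ler_pXn2r ?nnegrE //; exact: le_trans (q_le _ _) (flat_kinky _).
rewrite -mulr_suml sum_gap => hs; apply: le_trans (lerD (lexx _) hs) _.
rewrite -[X in X + _]mul1r -mulrDl ler_wpM2r ?sqr_ge0 // sqrrD expr1n.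
by have := gap_gt0 J; have := sqr_ge0 h; lrah.
Qed.

Let partialn_bounded : pbounded partialn.
Proof. by move=> x; exists ((1 + h) * kinky x) => J; exact: partialn_le. Qed.

Lemma seminorm_renorm : seminorm renorm.
Proof. exact: seminorm_supn. Qed.

Let kinky_renorm x : kinky x <= renorm x.
Proof. exact: (supn_ge 0 x partialn_bounded). Qed.

Lemma norm_le_renorm x : `|x| <= renorm x.
Proof. exact: le_trans (norm_flat x) (le_trans (flat_kinky x) (kinky_renorm x)). Qed.

(** Weights, kinks and added squares cost a factor [1 + h] each, and [(1 + h) ^+ 3 <= 1 + 7 * h] for
    [h <= 1]. *)
Lemma renorm_le x : renorm x <= (1 + 7 * h) * `|x|.
Proof.
apply: supn_le => J; apply: le_trans (partialn_le J x) _.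
apply: le_trans (ler_wpM2l _ (kinky_le x)) _; first by lrah.
rewrite mulrA ler_wpM2r // expr2.
have hh : h * h <= h by rewrite ler_piMl // ltW.
have : h * h * h <= h * h by rewrite ler_piMr // mulr_ge0 // ltW.
lrah.
Qed.

Let renorm8 x : renorm x <= 8 * `|x|.
Proof. by apply: le_trans (renorm_le x) _; rewrite ler_wpM2r //; lrah. Qed.

Let renorm_ge0 x : 0 <= renorm x. Proof. exact: seminorm_ge0 seminorm_renorm. Qed.

(** * Local uniform convexity of the new norm *)

Let partialn_mono J I x : (J <= I)%N -> partialn J x <= partialn I x.
Proof.
move=> /subnK <-; elim: (I - J)%N => // k IH; apply: le_trans IH _.
rewrite -(@ler_pXn2r _ 2) ?nnegrE // !partialn_sqr lerD2l addSn big_ord_recr /= lerDl.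
by rewrite mulr_ge0 ?sqr_ge0 // ltW ?gap_gt0.
Qed.

Let seminorm_parallelogram (p : Y -> R) x y : seminorm p ->
  (p x - p y) ^+ 2 <= 2 * p x ^+ 2 + 2 * p y ^+ 2 - (p (x + y)) ^+ 2.
Proof.
move=> sp; have : p (x + y) ^+ 2 <= (p x + p y) ^+ 2.
  by rewrite ler_pXn2r ?nnegrE ?addr_ge0 ?sp.1 // seminorm_ge0.
lra.
Qed.

(** Every square in the sum has a nonnegative parallelogram defect, so the total defect dominates
    that of the [i]-th term. *)
Let renorm_defect i x y :
  gap i * (q i x - q i y) ^+ 2 <= 2 * renorm x ^+ 2 + 2 * renorm y ^+ 2 - renorm (x + y) ^+ 2.
Proof.
set D := gap i * _; pose A := 2 * renorm x ^+ 2 + 2 * renorm y ^+ 2 - D.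
suff : renorm (x + y) ^+ 2 <= A by rewrite /A; lra.
have fin J : partialn J (x + y) ^+ 2 <= A.
  (* The partial sum is enlarged so as to contain the term [i]. *)
  pose I := maxn J i.+1.
  apply: (@le_trans _ _ (partialn I (x + y) ^+ 2)).
    by rewrite ler_pXn2r ?nnegrE //; apply: partialn_mono; exact: leq_maxl.
  have le2 z : partialn I z ^+ 2 <= renorm z ^+ 2.
    by rewrite ler_pXn2r ?nnegrE //; exact: supn_ge.
  suff : D <= 2 * partialn I x ^+ 2 + 2 * partialn I y ^+ 2 - partialn I (x + y) ^+ 2.
    by have := le2 x; have := le2 y; rewrite /A; lra.
  have iI : (i < I)%N by exact: leq_maxr.
  pose d j := gap j * (2 * q j x ^+ 2 + 2 * q j y ^+ 2 - q j (x + y) ^+ 2).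
  have dge j : gap j * (q j x - q j y) ^+ 2 <= d j.
    by apply: ler_wpM2l; [exact: ltW (gap_gt0 _)|exact: seminorm_parallelogram].
  have -> : 2 * partialn I x ^+ 2 + 2 * partialn I y ^+ 2 - partialn I (x + y) ^+ 2 =
      (2 * kinky x ^+ 2 + 2 * kinky y ^+ 2 - kinky (x + y) ^+ 2) + \sum_(j < I) d j.
    rewrite !partialn_sqr.
    have -> : \sum_(j < I) d j = 2 * \sum_(j < I) gap j * q j x ^+ 2 +
      2 * (\sum_(j < I) gap j * q j y ^+ 2) - \sum_(j < I) gap j * q j (x + y) ^+ 2.
      rewrite !mulr_sumr -big_split -sumrB /=; apply: eq_bigr => j _; rewrite /d; ring.
    by ring.
  rewrite (bigD1 (Ordinal iI)) //=.
  have s0 : 0 <= \sum_(j < I | j != Ordinal iI) d j.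
    apply: sumr_ge0 => j _; apply: le_trans (dge j).
    by rewrite mulr_ge0 ?sqr_ge0 // ltW ?gap_gt0.
  have := dge i; rewrite -/D.
  have := seminorm_parallelogram x y seminorm_kinky; have := sqr_ge0 (kinky x - kinky y); lra.
have A0 : 0 <= A by apply: le_trans (fin 0%N); exact: sqr_ge0.
rewrite -[leRHS]sqr_sqrtr // ler_pXn2r ?nnegrE ?sqrtr_ge0 //.
apply: supn_le => J; rewrite -(@ler_pXn2r _ 2) ?nnegrE ?sqrtr_ge0 //.
by rewrite sqr_sqrtr.
Qed.

(* If [v i] is close to [x] then [q i x] is small; the parallelogram defect makes
   [q i y] small too, so [y] is close to a multiple of [x]. *)
Lemma renorm_luc x (e : R) : renorm x = 1 -> 0 < e -> exists2 delta, 0 < delta &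
  forall y, renorm y = 1 -> 2 - delta < renorm (x + y) -> renorm (x - y) < e.
Proof.
move=> x1 e0; have sM := seminorm_renorm.
(* The final bound is [delta + 224 * eta <= 225 * eta], which 400 covers. *)
have [eta [eta0 eta1 etae]] :
    exists eta, [/\ 0 < eta, 400 * eta <= 1 & 400 * eta <= e].
  have m0 : 0 < Num.min e 1 by rewrite lt_min e0 ltr01.
  have m1 : Num.min e 1 <= 1 by rewrite ge_min lexx orbT.
  have me : Num.min e 1 <= e by rewrite ge_min lexx.
  by exists (Num.min e 1 / 400); split; lra.
have [i xi] := dv x eta0.
(* The parallelogram defect is at most [4 - (2 - delta) ^+ 2 <= 4 * delta], which is
   [gap i * eta ^+ 2]. *)
pose delta := gap i * eta ^+ 2 / 4.
have d0 : 0 < delta by rewrite divr_gt0 // mulr_gt0 ?gap_gt0 // exprn_gt0.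
have d1 : delta <= eta.
  have H : gap i * eta <= 1 by apply: mulr_ile1; have := gap_gt0 i; have := gap_le i; lrah.
  by have := ler_wpM2r (ltW eta0) H; rewrite /delta expr2; lra.
exists delta => // y y1 xy.
have Mxv := renorm8 (x - v i).
have qx : q i x <= 8 * eta.
  have := seminorm_leB x (v i) (seminorm_q i).
  rewrite /q [X in _ - X]quo_eq0 //; last exact: mem_span (mem_head _ _).
  rewrite -/(q i) subr0 => /le_trans; apply.
  apply: le_trans (q_le _ _) _; apply: le_trans (flat_kinky _) _.
  by apply: le_trans (kinky_renorm _) _; lra.
have qxy : (q i x - q i y) ^+ 2 <= eta ^+ 2.
  have := renorm_defect i x y; rewrite x1 y1 => H.
  have H2 : (2 - delta) ^+ 2 <= renorm (x + y) ^+ 2.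
    by rewrite ler_pXn2r ?nnegrE ?ltW //; lra.
  have H3 : gap i * (q i x - q i y) ^+ 2 <= gap i * eta ^+ 2.
    have : gap i * eta ^+ 2 = 4 * delta by rewrite /delta; lra.
    have := sqr_ge0 delta; lra.
  by move: H3; rewrite ler_pM2l ?gap_gt0.
have qy : q i y <= 9 * eta.
  move: qxy; rewrite -[(_ - _) ^+ 2](real_normK (num_real _)).
  by rewrite ler_pXn2r ?nnegrE ?(ltW eta0) // ler_norml => /andP[]; lra.
have [z [a zv] yz] := quo_lt seminorm_flat (subl i) y eta0; rewrite -/(q i) in yz.
have {}zv : z = a *: v i by apply/eqP; rewrite -subr_eq0; apply/eqP.
have yav : `|y - a *: v i| < 10 * eta.
  by rewrite -zv; apply: le_lt_trans (norm_flat _) _; lra.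
have Myv := renorm8 (y - a *: v i).
have a4 : `|a| <= 4.
  have := seminorm_leB (a *: v i) y sM; rewrite seminormBC // y1 sM.2.
  have := seminorm_leB x (v i) sM; rewrite x1.
  move=> H1 H2; have : 1 - 8 * eta <= renorm (v i) by lra.
  by move=> /(ler_wpM2l (normr_ge0 a)); have := ler_wpM2l (normr_ge0 a) eta1; lra.
have yax : renorm (y - a *: x) <= 112 * eta.
  have -> : y - a *: x = (y - a *: v i) + (- a) *: (x - v i).
    by rewrite scalerBr !scaleNr opprK addrA addrAC subrK.
  apply: le_trans (sM.1 _ _) _; rewrite sM.2 normrN.
  have := ler_pM (normr_ge0 _) (renorm_ge0 _) a4 (_ : renorm (x - v i) <= 8 * eta).
  by move=> /(_ ltac:(lra)); lra.
have a1 : `|a| <= 1 + 112 * eta.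
  by have := seminorm_leB (a *: x) y sM; rewrite seminormBC // y1 sM.2 x1; lra.
(* This excludes [a] near -1, where [y] would be close to [- x]. *)
have aD : 2 - delta - 112 * eta <= `|1 + a|.
  have : renorm (x + y) <= `|1 + a| * renorm x + renorm (y - a *: x).
    rewrite -sM.2; have -> : x + y = (1 + a) *: x + (y - a *: x).
      by rewrite scalerDl scale1r addrACA subrr addr0.
    exact: sM.1.
  by rewrite x1; lra.
have a1B : `|1 - a| <= delta + 112 * eta.
  move: a1 aD; rewrite ler_norml ler_norml => /andP[a1 a2].
  by have [|] := leP 0 (1 + a) => ?; [rewrite ger0_norm //|rewrite ltr0_norm //]; lra.
have : renorm (x - y) <= `|1 - a| * renorm x + renorm (y - a *: x).
  rewrite -sM.2 -(seminormN (y - _) sM).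
  have -> : x - y = (1 - a) *: x + - (y - a *: x).
    by rewrite scalerBl scale1r opprB addrA subrK.
  exact: sM.1.
by rewrite x1; lra.
Qed.

(** At [E n] the term [n] beats the others by at least [gap n / 4]: lower terms have weights smaller
    by at least [gap n], and for higher ones [chi m (E n) = 0]. Scaling by [t] multiplies the
    margin, whereas adding [y] costs at most [6 * |y|]; hence the constant 24. *)
Let flat_near n t y : 0 < t -> 24 * `|y| <= t * gap n ->
  let x := t *: E n + y in
  [/\ 0 < chi n x, kinky x = kink n x & flat x = cst n * chi n x].
Proof.
move=> t0 ty x; have g0 := gap_gt0 n; have gh := gap_le n.
have /andP[c1 c2] := cst_bnd n.
have E1 := ts_E1 ts n; have chiE := ts_chiE ts n; rewrite /tau in chiE.
have chiE1 : 1 + h - gap n - gap n / 4 <= cst n * chi n (E n).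
  apply: (@le_trans _ _ (cst n * (1 - gap n / 8))).
    have cE : cst n = 1 + h - gap n by [].
    by rewrite mulrBr mulr1; have := ler_wpM2r (ltW g0) c2; lra.
  by apply: ler_wpM2l => //; lra.
have other m : m != n -> kink m (E n) <= 1 + h - gap n - gap n / 2.
  rewrite neq_ltn => /orP[mn|nm]; have /andP[d1 d2] := cst_bnd m.
    have := ts_lt ts mn; have := gap_lt mn; rewrite /tau => H1 H2.
    apply: (@le_trans _ _ (cst m * (1 + gap n / 8))); first by apply: ler_wpM2l => //; lra.
    by rewrite mulrDr mulr1; have := ler_wpM2r (ltW g0) d2; have : cst m = 1 + h - gap m by []; lra.
  have [H1 H2] := ts_gt ts nm; rewrite /kink H1 normr0 add0r.
  have := ler_wpM2l kappa0 H2; rewrite mulr1 => H3.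
  have := ler_pM (_ : 0 <= cst m) (_ : 0 <= kappa * `|psi m (E n)|) d2 H3.
  rewrite mulr_ge0 // => /(_ ltac:(lra) isT); rewrite /kappa.
  by lrah.
have xE p : seminorm p -> (forall z, p z <= 4 * `|z|) -> p x <= t * p (E n) + 4 * `|y|.
  move=> sp p4; apply: le_trans (sp.1 _ _) _.
  by rewrite sp.2 ger0_norm ?(ltW t0) // lerD2l.
have chix : t * (cst n * chi n (E n)) - 2 * `|y| <= cst n * chi n x.
  have -> : chi n x = t * chi n (E n) + chi n y by rewrite /x linearD linearZ.
  rewrite mulrDr mulrCA lerD2l; have : `|chi n y| <= `|y| by exact: chiN.
  rewrite ler_norml => /andP[H _]; have := ler_wpM2l (_ : 0 <= cst n) H.
  by move=> /(_ ltac:(lra)); have := ler_wpM2r (normr_ge0 y) c2; lra.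
have tE := ler_wpM2l (ltW t0) chiE1; have y0 := normr_ge0 y.
have chi0 : 0 < cst n * chi n x.
  have : 0 < t * (1 + h - gap n - gap n / 4 - gap n / 12) by apply: mulr_gt0 => //; lra.
  lra.
have chip : 0 < chi n x by move: chi0; rewrite pmulr_rgt0 //; lra.
have kink4 m z : kink m z <= 4 * `|z|.
  by apply: le_trans (kink_le m z) _; rewrite ler_wpM2r // sqr4.
have norm_x : `|x| <= cst n * chi n x.
  have := xE _ seminorm_norm (fun z => _ : `|z| <= 4 * `|z|).
  rewrite E1 => /(_ (fun z => ltac:(have := normr_ge0 z; lra))) H.
  apply: le_trans H _; apply: le_trans chix.
  have := ler_wpM2l (ltW t0) (_ : 1 <= 1 + h - gap n - gap n / 2).
  move=> /(_ ltac:(lra)); lra.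
have kink_x m : m != n -> kink m x <= cst n * chi n x.
  move=> mn; apply: le_trans (xE _ (seminorm_kink m) (kink4 m)) _.
  apply: le_trans chix; have := ler_wpM2l (ltW t0) (other m mn); lra.
have face_n : face n x = cst n * chi n x by rewrite /face gtr0_norm.
have kink_n : cst n * chi n x <= kink n x by rewrite -face_n; exact: face_kink.
split => //.
  apply/eqP; rewrite eq_le; apply/andP; split; last first.
    by rewrite le_max supn_ge ?orbT.
  rewrite ge_max (le_trans norm_x kink_n) /=; apply: supn_le => m.
  by have [->//|mn] := eqVneq m n; exact: le_trans (kink_x m mn) kink_n.
apply/eqP; rewrite eq_le; apply/andP; split; last first.
  by rewrite -face_n le_max supn_ge ?orbT.
rewrite ge_max norm_x /=; apply: supn_le => m.
have [->|mn] := eqVneq m n; first by rewrite face_n.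
exact: le_trans (face_kink m x) (kink_x m mn).
Qed.

(** Moving along [v i] does not change [chi n], so the distance to the line is at least the value of
    [face n], which near [E n] is all of [flat]. *)
Let q_near n t y i : 0 < t -> 24 * `|y| <= t * gap n -> chi n (v i) = 0 ->
  q i (t *: E n + y) = cst n * chi n (t *: E n + y).
Proof.
move=> t0 ty vi; have [c0 _ fl] := flat_near t0 ty.
apply/eqP; rewrite eq_le -{1}fl q_le /=; apply: quo_ge => // z [a /eqP].
rewrite subr_eq0 => /eqP ->.
apply: (@le_trans _ _ (face n (t *: E n + y - a *: v i))).
  by rewrite /face linearB linearZ /= vi scaler0 subr0 gtr0_norm.
by rewrite le_max supn_ge ?orbT.
Qed.

Let sum_tail I J : \sum_(i < J) (if (I <= i)%N then gap i else 0) <= 2 * gap I.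
Proof.
have : \sum_(i < J) (if (I <= i)%N then gap i else 0) <=
    if (I <= J)%N then 2 * gap I - 2 * gap J else 0.
  elim: J => [|J IH]; first by rewrite big_ord0; case: I => //= ; lra.
  rewrite big_ord_recr /=; move: IH.
  have [IJ|JI] := leqP I J; first by rewrite leqW // gapS; lra.
  move=> H; rewrite addr0; apply: le_trans H _; case: ifP => // IJ.
  by rewrite (_ : I = J.+1) ?subrr //; apply/eqP; rewrite eqn_leq IJ JI.
by move/le_trans; apply; case: ifP => _; have := gap_gt0 I; have := gap_gt0 J; lra.
Qed.

(** Squares are compared term by term. Each difference of squares is estimated with the common
    factor [kinky x + kinky y], so the criterion does not depend on how far out [x] and [y] lie.
    Terms from [I] on are bounded crudely through [|x - y|], weighted by a tail of the [gap i]. *)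
Let renorm_lt I x y A rho B : 0 <= rho -> 0 <= B -> `|x - y| <= 2 * B ->
  A <= kinky x - kinky y ->
  (forall i, (i < I)%N -> - (4 * rho) <= q i x - q i y) ->
  4 * rho + 16 * B * gap I < A -> renorm y < renorm x.
Proof.
move=> rho0 B0 xyB kA qI ltA.
have A0 : 0 < A.
  by apply: le_lt_trans ltA; rewrite addr_ge0 ?mulr_ge0 // ltW ?gap_gt0.
have ky0 := kinky_ge0 y; have kx0 : 0 < kinky x by lra.
pose S := kinky x + kinky y; have S0 : 0 < S by rewrite ltr_wpDr.
pose err i := 4 * rho + (if (I <= i)%N then 8 * B else 0).
have err0 i : 0 <= err i by rewrite /err addr_ge0 ?mulr_ge0 //; case: ifP; rewrite ?mulr_ge0.
have qd i : - err i <= q i x - q i y.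
  have [Ii|iI] := leqP I i; last by rewrite /err leqNgt iI /= addr0; exact: qI.
  rewrite /err Ii lerNl opprB; apply: le_trans (seminorm_leB y x (seminorm_q i)) _.
  rewrite seminormBC //; apply: (@le_trans _ _ (8 * B)); last by rewrite lerDr mulr_ge0.
  apply: le_trans (q_le i _) _; apply: le_trans (flat_kinky _) _.
  apply: le_trans (kinky_le _) _.
  apply: le_trans (ler_pM (sqr_ge0 _) (normr_ge0 _) sqr4 xyB) _.
  by rewrite mulrA -natrM.
have qsq i : - (err i * S) <= q i x ^+ 2 - q i y ^+ 2.
  rewrite subr_sqr -mulNr.
  apply: (@le_trans _ _ (- err i * (q i x + q i y))).
    rewrite !mulNr lerN2 ler_wpM2l //; apply: lerD;
    exact: le_trans (q_le _ _) (flat_kinky _).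
  by rewrite ler_wpM2r // addr_ge0.
have serr J : \sum_(i < J) gap i * err i <= 4 * rho + 16 * B * gap I.
  have -> : \sum_(i < J) gap i * err i = (\sum_(i < J) gap i) * (4 * rho) +
      (\sum_(i < J) (if (I <= i)%N then gap i else 0)) * (8 * B).
    rewrite !mulr_suml -big_split /=; apply: eq_bigr => i _.
    by rewrite /err mulrDr; case: ifP => _; rewrite ?mulr0 ?mul0r.
  apply: lerD.
    rewrite ler_piMl ?mulr_ge0 // sum_gap lerBlDr; apply: le_trans h1 _.
    by rewrite lerDl mulr_ge0 // ltW ?gap_gt0.
  apply: le_trans (ler_wpM2r _ (sum_tail I J)) _; first by rewrite mulr_ge0.
  by rewrite mulrACA [gap I * B]mulrC mulrA -natrM.
(* A surplus independent of [J] keeps the inequality strict after the supremum. *)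
pose D := A - (4 * rho + 16 * B * gap I).
have D0 : 0 < D by rewrite subr_gt0.
have partd J : partialn J y ^+ 2 + S * D <= partialn J x ^+ 2.
  have H1 : - ((4 * rho + 16 * B * gap I) * S) <=
     \sum_(i < J) gap i * q i x ^+ 2 - \sum_(i < J) gap i * q i y ^+ 2.
    rewrite -sumrB; apply: (@le_trans _ _ (\sum_(i < J) - (gap i * err i * S))).
      by rewrite sumrN -mulr_suml lerN2 ler_wpM2r ?(ltW S0).
    by apply: ler_sum => i _; rewrite -mulrA -mulrN -mulrBr ler_wpM2l ?(ltW (gap_gt0 _)).
  have H2 : A * S <= kinky x ^+ 2 - kinky y ^+ 2.
    by rewrite subr_sqr ler_wpM2r // ltW.
  rewrite !partialn_sqr /D; lra.
have T0 : 0 < renorm x by exact: lt_le_trans (kinky_renorm x).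
have fin J : partialn J y ^+ 2 <= renorm x ^+ 2 - S * D.
  rewrite lerBrDr; apply: le_trans (partd J) _.
  by rewrite ler_pXn2r ?nnegrE ?(ltW T0) //; exact: supn_ge.
have TD : 0 <= renorm x ^+ 2 - S * D by apply: le_trans (fin 0%N); exact: sqr_ge0.
apply: (@le_lt_trans _ _ (Num.sqrt (renorm x ^+ 2 - S * D))).
  apply: supn_le => J; rewrite -(@ler_pXn2r _ 2) ?nnegrE ?sqrtr_ge0 //.
  by rewrite sqr_sqrtr.
rewrite -[ltRHS](gtr0_norm T0) -sqrtr_sqr ltr_sqrt ?exprn_gt0 //.
by rewrite ltrBlDr ltrDl mulr_gt0.
Qed.

(* Far out in the direction [E n] only the kink [psi n] distinguishes the points
   of a bounded set on which [chi n] nearly vanishes. *)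
Lemma renorm_tilt n I (s delta t th rho B gam : R) (f : {linear Y -> R^o}) k a :
  s = 1 \/ s = -1 -> 0 < t -> 24 * (delta + B) <= t * gap n -> 0 <= rho ->
  0 <= th -> (forall x, `|f x| <= `|x|) ->
  (forall i, (i < I)%N -> chi n (v i) = 0) ->
  (forall z, z = k \/ z = a ->
    [/\ `|z| <= B, `|chi n z| <= rho & `|psi n z - th * f z| <= rho]) ->
  2 * (th * B + rho) <= delta ->
  s * f k < s * f a - gam ->
  7 * rho + 16 * B * gap I < kappa * (th * gam) ->
  renorm (t *: E n + (s * delta) *: W n - a) < renorm (t *: E n + (s * delta) *: W n - k).
Proof.
move=> s1 t0 tB rho0 th0 fN flatI Hz dB kag small.
set x0 := t *: E n + _; have /andP[c1 c2] := cst_bnd n.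
have [[kB chik psik] [aB chia psia]] := (Hz k (or_introl erefl), Hz a (or_intror erefl)).
have sn : `|s| = 1 by case: s1 => ->; rewrite ?normrN normr1.
have B0 : 0 <= B := le_trans (normr_ge0 _) kB.
have del0 : 0 <= delta by apply: le_trans dB; rewrite mulr_ge0 // addr_ge0 // mulr_ge0.
have psiW := ts_psiW ts n; have W1 := ts_W1 ts n.
have near z : z = k \/ z = a -> 24 * `|(s * delta) *: W n - z| <= t * gap n.
  move=> /Hz[zB _ _]; apply: le_trans tB; rewrite ler_pM2l //.
  apply: le_trans (ler_normB _ _) _; rewrite normrZ W1 mulr1 normrM sn mul1r ger0_norm //.
  by rewrite lerD2l.
(* The shift by [delta *: W n] outweighs [psi n z], because [psi n (W n) >= 1/2] and
   [delta >= 2 * (th * B + rho)]. So both points lie on the same side of the kink and the absolute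
   value opens with the sign [s]. *)
have psix z : z = k \/ z = a ->
    `|psi n (x0 - z)| = delta * psi n (W n) - s * psi n z.
  move=> /Hz[zB _ pz].
  have -> : psi n (x0 - z) = s * (delta * psi n (W n) - s * psi n z).
    rewrite /x0 linearB linearD !linearZ /= (ts_psiE ts) scaler0 add0r /GRing.scale /=.
    by case: s1 => ->; ring.
  rewrite normrM sn mul1r ger0_norm // subr_ge0.
  apply: (@le_trans _ _ (th * B + rho)).
    apply: le_trans (ler_norm _) _; rewrite normrM sn mul1r.
    have -> : psi n z = th * f z + (psi n z - th * f z) by ring.
    apply: le_trans (ler_normD _ _) _; apply: lerD => //.
    by rewrite normrM ger0_norm // ler_wpM2l // (le_trans (fN z)).
  have := ler_wpM2l del0 psiW; lra.
have chix z : chi n (x0 - z) = chi n x0 - chi n z by rewrite linearB.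
have x0E z : x0 - z = t *: E n + ((s * delta) *: W n - z) by rewrite addrA.
have [pk Nk Fk] := flat_near t0 (near k (or_introl erefl)).
have [pa Na Fa] := flat_near t0 (near a (or_intror erefl)).
rewrite -x0E in pk Nk Fk; rewrite -x0E in pa Na Fa.
have sab z r : `|z| <= r -> - r <= s * z <= r.
  by move=> zr; rewrite -ler_norml normrM sn mul1r.
have psid : th * gam - 2 * rho <= s * psi n a - s * psi n k.
  have /andP[H1 _] := sab _ _ psia; have /andP[_ H2] := sab _ _ psik.
  have H3 : th * gam <= th * (s * f a - s * f k).
    by apply: ler_wpM2l => //; rewrite lerBrDl -lerBrDr ltW.
  lra.
have chid : - (2 * rho) <= chi n a - chi n k.
  by move: chik chia; rewrite !ler_norml => /andP[_ H1] /andP[H2 _]; lra.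
have k1 : kappa * (2 * rho) <= rho.
  rewrite mulrA ler_piMl // /kappa mulrC mulrA ler_pdivrMr // mul1r.
  by have H := h1; lra.
have gB := mulr_ge0 B0 (ltW (gap_gt0 I)).
(* The loss [3 * rho] consists of [2 * rho] from [chi n] and [kappa * (2 * rho) <= rho] from
   [psi n]. *)
apply: (@renorm_lt I _ _ (kappa * (th * gam) - 3 * rho) rho B) => //.
- have -> : x0 - k - (x0 - a) = a - k by rewrite opprB addrC addrA subrK.
  by apply: le_trans (ler_normB _ _) _; lra.
- rewrite Nk Na /kink !psix; [|by right|by left].
  rewrite !gtr0_norm // !chix -mulrBr.
  have H : kappa * (th * gam) - 3 * rho <=
    chi n x0 - chi n k + kappa * (delta * psi n (W n) - s * psi n k) -
    (chi n x0 - chi n a + kappa * (delta * psi n (W n) - s * psi n a)).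
    have := ler_wpM2l kappa0 psid; lra.
  have A3 : 0 <= kappa * (th * gam) - 3 * rho by lra.
  by apply: (le_trans H); rewrite ler_peMl // (le_trans A3 H).
- move=> i iI; rewrite !x0E !q_near ?flatI //; [|exact: near (or_intror _)|exact: near (or_introl _)].
  rewrite -!x0E !chix -mulrBr.
  have -> : chi n x0 - chi n k - (chi n x0 - chi n a) = chi n a - chi n k by ring.
  have c0 : 0 <= cst n by exact: le_trans c1.
  apply: le_trans (ler_wpM2l c0 chid); rewrite mulrN lerN2.
  by apply: le_trans (ler_wpM2r _ c2) _; rewrite ?mulr_ge0 // mulrA -natrM.
- lra.
Qed.

End Renorming.

(** * Nearest points *)

Section NearestPoints.
Context {R : realType} {X : normedModType R}.

Lemma midpoint_mem (K : set X) x y : convex_set K -> K x -> K y -> K (2^-1 *: (x + y)).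
Proof.
move=> cK Kx Ky.
have l0 : 0 <= 2^-1 :> R by rewrite invr_ge0.
have l1 : 2^-1 <= 1 :> R by lra.
pose l : {i01 R} := Itv01 l0 l1.
have := cK x y l (mem_set Kx) (mem_set Ky); rewrite inE.
suff -> : conv l (x : convex_lmodType X) y = 2^-1 *: (x + y) by [].
rewrite /conv /= scalerDr; congr (_ + _ *: _).
have E : 1 - 2^-1 = 2^-1 :> R by lra.
exact: E.
Qed.

Lemma nearest_point_mapP (K : set X) f : nearest_point_map K f <->
  forall x, K (f x) /\ forall k, K k -> `|x - f x| <= `|x - k|.
Proof.
split=> h x; have [Kf hf] := h x; split=> //.
  move=> k Kk; rewrite hf; apply: ge_inf; last by exists k.
  by exists 0 => _ [z _ <-].
apply/eqP; rewrite eq_le; apply/andP; split.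
  apply: lb_le_inf; first by exists `|x - f x|; exists (f x).
  by move=> _ [k Kk <-]; exact: hf.
apply: ge_inf; last by exists (f x).
by exists 0 => _ [z _ <-].
Qed.

Definition strictly_convex := forall x y : X,
  `|x| = 1 -> `|y| = 1 -> `|x + y| = 2 -> x = y.

Lemma luc_strictly_convex : locally_uniformly_convex X -> strictly_convex.
Proof.
move=> luc x y x1 y1 xy; have := luc x (fun=> y) x1 (fun=> y1).
rewrite normrZ xy normfV normr_nat mulVf // => /(_ (cvg_cst _)) => h.
have hc : `|x - y| @[_ --> \oo] --> `|x - y| by exact: cvg_cst.
have E : `|x - y| = 0 by apply: (cvg_unique _ hc h); exact: norm_hausdorff.
by apply/eqP; rewrite -subr_eq0 -normr_eq0 E.
Qed.

(** The midpoint of two nearest points lies in [K], hence is no nearer to [x]; after rescaling to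
    the unit sphere this is the equality case of strict convexity. Distance 0 is treated apart, as
    it cannot be rescaled. *)
Lemma nearest_point_uniq (K : set X) x p k : strictly_convex -> convex_set K ->
  K p -> K k -> (forall z, K z -> `|x - p| <= `|x - z|) -> `|x - k| <= `|x - p| -> p = k.
Proof.
move=> sX cK Kp Kk pmin kp.
have kpE : `|x - k| = `|x - p| by apply/eqP; rewrite eq_le kp pmin.
have [d0|d0] := eqVneq `|x - p| 0.
  have := d0; rewrite -kpE => /eqP; rewrite normr_eq0 subr_eq0 => /eqP <-.
  by move/eqP: d0; rewrite normr_eq0 subr_eq0 => /eqP <-.
have dp : 0 < `|x - p| by rewrite lt_def d0 normr_ge0.
pose c := `|x - p|^-1; have c0 : 0 < c by rewrite invr_gt0.
have unit z : `|x - z| = `|x - p| -> `|c *: (x - z)| = 1.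
  by move=> zE; rewrite normrZ gtr0_norm // zE mulVf.
have := sX _ _ (unit p erefl) (unit k kpE); rewrite -scalerDr.
have mid := pmin _ (midpoint_mem cK Kp Kk).
have E : x - p + (x - k) = 2 *: (x - 2^-1 *: (p + k)).
  by rewrite scalerBr scalerA divff // scale1r scaler_nat mulr2n opprD addrACA.
have -> : `|c *: (x - p + (x - k))| = 2.
  apply/eqP; rewrite eq_le; apply/andP; split.
    rewrite scalerDr; apply: le_trans (ler_normD _ _) _.
    by rewrite unit // unit.
  rewrite normrZ gtr0_norm // E normrZ ger0_norm // mulrCA ler_pMr //.
  by rewrite -[leLHS](mulVf d0) -/c ler_pM2l.
move=> /(_ erefl) /(scalerI (lt0r_neq0 c0)) /(addrI x) /oppr_inj; exact.
Qed.

Lemma nearest_point_exists (K : set X) : strictly_convex -> compact K -> convex_set K ->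
  K !=set0 -> exists f, unique (nearest_point_map K) f /\ continuous f.
Proof.
move=> sX coK cK K0.
have distc (A : set X) x : {within A, continuous (fun k => `|x - k|)}.
  apply: continuous_subspaceT; apply: (@lipschitz_continuous _ X R^o _ 1) => y z.
  by rewrite mul1r; apply: le_trans (ler_dist_dist _ _) _; rewrite opprB addrC addrA subrK distrC.
have /choice[f fP] : forall x, exists p, K p /\ forall k, K k -> `|x - p| <= `|x - k|.
  move=> x; have [p Kp pmin] := compact_EVT_min K0 coK (distc K x).
  by exists p; split; [exact: set_mem|move=> k Kk; apply: pmin; exact: mem_set].
exists f; split.
  split; first by apply/nearest_point_mapP.
  move=> f' /nearest_point_mapP f'P; apply/funext => x.
  have [Kf fmin] := fP x; have [Kf' fmin'] := f'P x.
  exact: nearest_point_uniq sX cK Kf Kf' fmin (fmin' _ Kf).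
move=> x; apply/cvgrPdist_lt => e e0; have [Kf fmin] := fP x.
(* By uniqueness, the minimum over the compact set [A] of the distance to [x] strictly exceeds the
   distance from [x] to [K]. If [y] is within half of the excess, its nearest point cannot be in
   [A]. *)
pose A := K `&` [set k | e <= `|f x - k|].
have coA : compact A.
  apply: compact_closedI => //.
  have -> : [set k | e <= `|f x - k|] = (fun k => `|f x - k|) @^-1` [set r | e <= r] by [].
  apply: closed_comp; last exact: closed_ge.
  move=> y _; apply: (@lipschitz_continuous _ X R^o (fun k => `|f x - k|) 1) => {}y z.
  by rewrite mul1r; apply: le_trans (ler_dist_dist _ _) _; rewrite opprB addrC addrA subrK distrC.
have [A0|A0] := pselect (A !=set0); last first.
  apply: filterS filterT => y _; rewrite ltNge; apply/negP => h; apply: A0.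
  by exists (f y); split => //; have [] := fP y.
have [c /set_mem[Kc ce] cmin] := compact_EVT_min A0 coA (distc A x).
have lt_c : `|x - f x| < `|x - c|.
  rewrite ltNge; apply/negP => h.
  have fc := nearest_point_uniq sX cK Kf Kc fmin h.
  by move: ce; rewrite /= fc subrr normr0 leNgt e0.
have : 0 < (`|x - c| - `|x - f x|) / 2 by rewrite divr_gt0 // subr_gt0.
set d := _ / 2 => d0.
near=> y; rewrite ltNge; apply/negP => h.
have [Kfy fymin] := fP y.
have := cmin (f y) (mem_set (conj Kfy h)).
have xy : `|x - y| < d by near: y; apply: cvgr_dist_lt => //.
have h1 : `|x - f y| <= `|x - y| + `|y - f y|.
  by rewrite -[x - f y](subrKA y); exact: ler_normD.
have h2 : `|y - f x| <= `|x - y| + `|x - f x|.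
  by rewrite -[y - f x](subrKA x) [`|x - y|]distrC; exact: ler_normD.
have h3 := fymin _ Kf; move: xy; rewrite /d; lra.
Unshelve. all: by end_near. Qed.

End NearestPoints.

(** * Equivalent norms and the renormed Banach space *)

Section RenormedSpace.
Context {R : realType} {Y : completeNormedModType R}.

(** The lower constant is normalised to 1, so the identity back to [Y] is a contraction and any
    upper constant bounds the isomorphism constant. *)
Record equivalent_norm := EquivalentNorm {
  enorm :> Y -> R;
  enorm_seminorm : seminorm enorm;
  enorm_ge : forall x, `|x| <= enorm x;
  enorm_bound : R;
  enorm_le : forall x, enorm x <= enorm_bound * `|x| }.

(** A copy of [Y] indexed by the norm, so that the new norm and topology do not clash with those of
    [Y]. *)
Definition renormed (M : equivalent_norm) : Type := Y.

Section Instances.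
Context (M : equivalent_norm).

HB.instance Definition _ := GRing.Lmodule.on (renormed M).

Let enorm0_eq0 (x : renormed M) : M x = 0 -> x = 0.
Proof.
move=> x0; have := enorm_ge M x; rewrite x0 normr_le0 => /eqP; exact.
Qed.

HB.instance Definition _ := Lmodule_isNormed.Build R (renormed M)
  (enorm_seminorm M).1 (enorm_seminorm M).2 enorm0_eq0.

Lemma renormed_normE (x : renormed M) : `|x| = M x. Proof. by []. Qed.

Let renormed_complete (F : set_system (renormed M)) :
  ProperFilter F -> cauchy F -> cvg F.
Proof.
move=> PF /cauchyP Fc.
have FcY : cauchy (F : set_system Y).
  apply/cauchyP => e e0; have [x Fx] := Fc e e0; exists x.
  apply: filterS Fx => y; rewrite -!ball_normE /ball_ /= => xy.
  exact: le_lt_trans (enorm_ge M _) xy.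
have /cvg_ex[l /cvgrPdist_lt Fl] := @cauchy_cvg Y F PF FcY.
apply/cvg_ex; exists (l : renormed M); apply/cvgrPdist_lt => e e0.
have b0 : 0 < `|enorm_bound M| + 1 by rewrite ltr_wpDl.
have := Fl (e / (`|enorm_bound M| + 1)) (divr_gt0 e0 b0).
apply: filterS => y; rewrite ltr_pdivlMr // => ly.
apply: le_lt_trans ly; rewrite renormed_normE; apply: le_trans (enorm_le M _) _.
rewrite mulrC; apply: ler_wpM2l => //.
by apply: le_trans (ler_norm _) _; rewrite lerDl.
Qed.

HB.instance Definition _ := Uniform_isComplete.Build (renormed M) renormed_complete.

End Instances.

Lemma renormed_isomorphic (M : equivalent_norm) (c : R) :
  (exists x : Y, x != 0) -> (forall x, M x <= c * `|x|) ->
  isomorphic_with_const c Y (renormed M : completeNormedModType R).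
Proof.
move=> [x0 x0n0] Mc.
have c0 : 0 <= c.
  have x00 : 0 < `|x0| by rewrite normr_gt0.
  have := le_trans (normr_ge0 x0) (le_trans (enorm_ge M x0) (Mc x0)).
  by rewrite pmulr_lge0.
pose Tf (x : Y) : renormed M := x; pose Sf (x : renormed M) : Y := x.
have Tlin : linear Tf by [].
have Slin : linear Sf by [].
pose T : {linear Y -> renormed M} := HB.pack Tf (GRing.isLinear.Build _ _ _ _ Tf Tlin).
pose S : {linear renormed M -> Y} := HB.pack Sf (GRing.isLinear.Build _ _ _ _ Sf Slin).
exists T, S; split => //.
- apply: (@lipschitz_continuous _ Y (renormed M) Tf c) => x y; exact: Mc.
- apply: (@lipschitz_continuous _ (renormed M) Y Sf 1) => x y.
  by rewrite mul1r; exact: (enorm_ge M).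
have nonneg (V W : normedModType R) (f : V -> W) : 0 <= opnorm f.
  rewrite /opnorm; set A := [set _ | _ in _].
  have [[A0 ubA]|/sup_out ->//] := pselect (has_sup A).
  by have [r Ar] := A0; apply: le_trans (ub_le_sup ubA Ar); case: Ar => x _ <-.
rewrite -[leRHS]mulr1; apply: ler_pM => //; apply: ge_sup.
- by exists `|T 0|; exists 0 => //=; rewrite normr0.
- move=> _ [x /= x1 <-]; apply: le_trans (Mc x) _.
  by rewrite ler_piMr.
- by exists `|S 0|; exists 0 => //=; rewrite normr0.
- by move=> _ [x /= x1 <-]; apply: le_trans (enorm_ge M x) x1.
Qed.

End RenormedSpace.

(** * Failure of uniform continuity *)

(** The dense set is enumerated through an injection into the naturals; numbers outside its range
    are sent to 0. *)
Lemma dense_sequence {R : realType} {Y : normedModType R} : separable Y ->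
  exists v : nat -> Y, forall x (d : R), 0 < d -> exists i, `|x - v i| < d.
Proof.
move=> [D /countable_injP[f finj] dD].
exists (fun n => xget 0 [set x | D x /\ f x = n]) => x d d0.
have [|y [/= xy Dy]] := dD (ball x d) _ (ball_open x d).
  by exists x; exact: ballxx.
exists (f y); have [Dz fz] := xgetPex 0 (ex_intro [set z | D z /\ f z = f y] y (conj Dy erefl)).
rewrite (finj _ _ (mem_set Dz) (mem_set Dy) fz).
by move: xy; rewrite -ball_normE.
Qed.

Lemma compact_net {R : realType} {X : normedModType R} (K : set X) (v : nat -> X) (r : R) :
  compact K -> (forall x d, 0 < d -> exists i, `|x - v i| < d) -> 0 < r ->
  exists N, forall k, K k -> exists2 i, (i < N)%N & `|k - v i| < r.
Proof.
rewrite compact_cover => coK dv r0.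
have [||D _ KD] := coK nat setT (fun i => ball (v i) r).
- by move=> i _; exact: ball_open.
- move=> x _; have [i xi] := dv x r r0; exists i => //.
  by rewrite -ball_normE /ball_ /= distrC.
exists (\max_(i <- finmap.enum_fset D) i).+1 => k /KD[i iD]; rewrite -ball_normE /ball_ /= distrC => ki.
by exists i => //; rewrite ltnS; apply: (@leq_bigmax_seq _ (finmap.enum_fset D) xpredT id).
Qed.

Section TiltedNorm.
Context {R : realType} {Y : completeNormedModType R} (v : nat -> Y) (h : R)
  (E W : nat -> Y) (chi psi g : nat -> {linear Y -> R^o}) (M : @equivalent_norm R Y).
Hypotheses (h0 : 0 < h) (h1 : h <= 1)
  (ts : tilted_system v (kappa h) (tau h) E W chi psi g)
  (dv : forall x (d : R), 0 < d -> exists i, `|x - v i| < d)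
  (ME : forall x, M x = renorm v h chi psi x).

Local Notation Z := (renormed M : completeNormedModType R).

Lemma tilted_luc : locally_uniformly_convex Z.
Proof.
move=> x y x1 y1 xy; apply/cvgr0Pnorm_lt => e e0.
have [d d0 hd] : exists2 d, 0 < d & forall z : Z, M z = 1 -> 2 - d < M (x + z) -> M (x - z) < e.
  have Mx : renorm v h chi psi x = 1 by rewrite -ME.
  have [d d0 hd] := renorm_luc h0 h1 ts dv Mx e0.
  by exists d => // z; rewrite !ME; exact: hd.
have d2 : 0 < d / 2 by rewrite divr_gt0.
move/cvgrPdist_lt : xy => /(_ _ d2); apply: filterS => n.
rewrite normrZ ger0_norm ?invr_ge0 // => hn; rewrite normr_id.
apply: hd; first exact: y1.
rewrite -renormed_normE; move: hn; rewrite ltr_norml => /andP[_].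
by lra.
Qed.

Let gap_small c : 0 < c -> exists N, forall n, (N <= n)%N -> gap h n < c.
Proof.
move=> c0; have [N hN] : exists N, gap h N < c.
  have := cvg_geometric h (_ : `|2^-1| < 1 :> R).
  rewrite ger0_norm ?invr_ge0 // => /(_ ltac:(lra))/cvgrPdist_lt/(_ c c0)[N _ hN].
  exists N; apply: le_lt_trans (hN N (leqnn N)).
  rewrite /= sub0r normrN ger0_norm ?mulr_ge0 ?(ltW h0) ?exprn_ge0 ?invr_ge0 //.
  rewrite /gap exprVn ler_pM2l // lef_pV2 ?posrE ?exprn_gt0 //.
  by rewrite exprS ler_peMl ?exprn_ge0 // ler1n.
exists N => n; rewrite leq_eqVlt => /predU1P[<-//|Nn].
have := gap_lt h0 Nn; have := gap_gt0 h0 n; lra.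
Qed.

Lemma tilted_not_unif (K : set Z) (f : Z -> Z) : compact K ->
  (exists x y, [/\ K x, K y & x != y]) -> nearest_point_map K f -> ~ unif_continuous f.
Proof.
move=> coK [x1 [x2 [Kx1 Kx2 x12]]] /nearest_point_mapP fP /unif_continuousP uc.
have [j [p [q [Kp Kq gpq]]]] : exists j (p q : Z), [/\ K p, K q & (g j q : R) < g j p].
  have x120 : (x1 : Y) - x2 != 0 by rewrite subr_eq0.
  have [j] := ts_sep ts x120.
  rewrite linearB subr_eq0 /= neq_lt => /orP[lt|lt]; exists j.
    by exists x2, x1.
  by exists x1, x2.
(* Each of the two nearest points misses the extreme value by at most [gam], so their values under
   [g j] still differ by [2 * gam]. *)
pose gam : R := (g j p - g j q) / 4.
have gam0 : 0 < gam by rewrite divr_gt0 // subr_gt0.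
have [d d0 ucd] := uc gam gam0.
have [B B1 KB] : exists2 B, 1 <= B & forall k, K k -> `|k : Y| <= B.
  have /pinfty_ex_gt0[B B0 hB] := compact_bounded coK.
  exists (Num.max B 1); first by rewrite le_max lexx orbT.
  move=> k /hB kB; apply: le_trans (enorm_ge M k) _.
  by rewrite le_max; apply/orP; left.
(* The new norm is at most 8 at [W n], so the two test points are at distance at most
   [16 * delta = d / 2]. *)
pose delta := d / 32; have delta0 : 0 < delta by rewrite divr_gt0.
(* Together with [rho <= delta / 4] this gives [2 * (th * B + rho) <= delta]. *)
have [m mB] : exists m, ((m + 10)%:R^-1 : R) * B <= delta / 4.
  have d4B : 0 < B * 4 / delta by rewrite !divr_gt0 ?mulr_gt0 //; apply: lt_le_trans B1.
  exists (Num.bound (B * 4 / delta)).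
  have := archi_boundP (ltW d4B); set m := Num.bound _ => hm.
  have mp : 0 < (m + 10)%:R :> R by rewrite ltr0n addn_gt0 orbT.
  rewrite mulrC ler_pdivrMr // -ler_pdivrMl ?divr_gt0 //.
  have -> : (delta / 4)^-1 * B = B * 4 / delta by rewrite invfM invrK; ring.
  by apply: ltW (lt_le_trans hm _); rewrite ler_nat leq_addr.
pose th : R := (m + 10)%:R^-1; rewrite -/th in mB.
have th0 : 0 < th by rewrite invr_gt0 ltr0n addn_gt0 orbT.
have th1 : th <= 1 by rewrite invf_le1 ?ler1n ?ltr0n addn_gt0 orbT.
have k0 : 0 < kappa h by rewrite divr_gt0.
pose A := kappa h * (th * gam).
have A0 : 0 < A by rewrite mulr_gt0 // mulr_gt0.
(* The errors sum to less than [A]: [7 * rho] is at most [7/16 * A], and the tail from [I] on is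
   less than [A / 2]. *)
have [rho [rho0 rhod rhoA]] : exists rho, [/\ 0 < rho, rho <= delta / 4 & 16 * rho <= A].
  exists (Num.min (delta / 4) (A / 16)); split; first by rewrite lt_min !divr_gt0.
    by rewrite ge_min lexx.
  have : Num.min (delta / 4) (A / 16) <= A / 16 by rewrite ge_min lexx orbT.
  lra.
have B0 : 0 < B by exact: lt_le_trans B1.
have [I1 hI1] : exists N, forall n, (N <= n)%N -> gap h n < A / (64 * B).
  by apply: gap_small; rewrite divr_gt0 // mulr_gt0.
(* [psi n - th * g j] has norm at most 6 + 1 = 7 and vanishes on the net. *)
have r7 : 0 < rho / 7 by rewrite divr_gt0.
have b0 : 0 < `|enorm_bound M| + 1 by rewrite ltr_wpDl.
have dvZ (x : Z) e : 0 < e -> exists i, `|x - (v i : Z)| < e.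
  move=> e0; have [i xi] := dv x (divr_gt0 e0 b0); exists i.
  rewrite renormed_normE; apply: le_lt_trans (enorm_le M _) _.
  move: xi; rewrite ltr_pdivlMr // => xi; apply: le_lt_trans xi.
  rewrite mulrC; apply: ler_wpM2l => //.
  by apply: le_trans (ler_norm _) _; rewrite lerDl.
have [I2 hI2] := compact_net (v := v : nat -> Z) coK dvZ r7.
pose I := maxn I1 I2.
have gI : 16 * B * gap h I < A / 2.
  have := hI1 I (leq_maxl _ _); rewrite ltr_pdivlMr ?mulr_gt0 //; lra.
have [n hn] := ts_flat ts j m I.
have Kflat z : K z -> [/\ `|z : Y| <= B, `|chi n z| <= rho & `|psi n z - th * g j z| <= rho].
  move=> Kz; have [i iI zi] := hI2 z Kz.
  have [chi0 psi0] := hn i (leq_trans (ltnW iI) (leq_maxr _ _)).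
  have {}zi : `|(z : Y) - v i| <= rho / 7 := le_trans (enorm_ge M _) (ltW zi).
  split; first exact: KB.
    rewrite -[chi n z]subr0 -chi0 -linearB; apply: le_trans (ts_chi ts n _) _.
    by apply: le_trans zi _; lra.
  have -> : psi n z - th * g j z = psi n ((z : Y) - v i) - th * g j ((z : Y) - v i).
    by rewrite !linearB /= psi0 -/th; ring.
  apply: le_trans (ler_normB _ _) _; rewrite normrM gtr0_norm //.
  have H1 := ts_psi ts n ((z : Y) - v i).
  have := ler_pM (ltW th0) (normr_ge0 _) th1 (ts_g ts j ((z : Y) - v i)).
  by move: H1 zi; lra.
have gn := gap_gt0 h0 n.
pose t := 24 * (delta + B) / gap h n.
have t0 : 0 < t by rewrite divr_gt0 // mulr_gt0 // addr_gt0.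
pose pt s : Z := t *: E n + (s * delta) *: W n.
have tilt s k a : s = 1 \/ s = -1 -> K k -> K a ->
    (forall z, K z -> `|pt s - k| <= `|pt s - z|) -> s * (g j a : R) - gam <= s * g j k.
  move=> s1 Kk Ka kmin; rewrite leNgt; apply/negP => lt.
  have := kmin a Ka; rewrite leNgt => /negP; apply.
  rewrite !renormed_normE !ME.
  apply: (renorm_tilt h0 h1 ts (I := I) (B := B) (rho := rho) (th := th) (gam := gam) (f := g j)) => //.
  - by rewrite /t divfK ?gt_eqF.
  - exact: ltW.
  - exact: ltW.
  - exact: (ts_g ts j).
  - by move=> i iI; have [] := hn i (ltnW iI).
  - by move=> z [->|->]; exact: Kflat.
  - by move: mB rhod; lra.
  - by move: gI rhoA rho0; rewrite /A; lra.
have [Kf1 min1] := fP (pt 1); have [Kfm minm] := fP (pt (-1)).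
have T1 := tilt 1 _ _ (or_introl erefl) Kf1 Kp min1.
have Tm := tilt (-1) _ _ (or_intror erefl) Kfm Kq minm.
have closept : ball (pt 1) d (pt (-1)).
  rewrite -ball_normE /ball_ /=.
  rewrite renormed_normE.
  have -> : pt 1 - pt (-1) = (2 * delta) *: W n.
    rewrite /pt opprD addrACA subrr add0r -scalerBl; congr (_ *: _); ring.
  have d20 : 0 <= 2 * delta by rewrite mulr_ge0 // ltW.
  rewrite (enorm_seminorm M).2 ger0_norm // ME.
  have WM : renorm v h chi psi (W n) <= 8.
    apply: le_trans (renorm_le h0 h1 ts _) _.
    by rewrite (ts_W1 ts) mulr1; have := h1; lra.
  by apply: le_lt_trans (ler_wpM2l d20 WM) _; rewrite /delta; lra.
have := ucd (pt 1, pt (-1)) closept; rewrite -ball_normE /ball_ /=.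
rewrite ltNge => /negP; apply.
apply: le_trans (enorm_ge M _); apply: le_trans (ts_g ts j _).
apply: le_trans (ler_norm _); rewrite linearB /=.
by move: T1 Tm; rewrite /gam !mul1r !mulN1r; lra.
Qed.

End TiltedNorm.

Theorem luc_renorming {R : realType} (Y : completeNormedModType R) (eps : R) :
  ~ finite_dimensional Y -> separable Y -> 0 < eps ->
  exists M : @equivalent_norm R Y,
  [/\ locally_uniformly_convex (renormed M),
      isomorphic_with_const (1 + eps) Y (renormed M)
    & compact_convex_nearest_not_unif (renormed M)].
Proof.
move=> infY sepY eps0.
have [v dv] := dense_sequence sepY.
(* Chosen so that the bound [1 + 7 * h] of [renorm_le] is at most [1 + eps]. *)
pose h := Num.min 1 (eps / 7).
have h0 : 0 < h by rewrite lt_min ltr01 divr_gt0.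
have h1 : h <= 1 by rewrite ge_min lexx.
have h7 : 7 * h <= eps.
  have : h <= eps / 7 by rewrite ge_min lexx orbT.
  lra.
have gh n : gap h n <= 1.
  rewrite ler_pdivrMr ?exprn_gt0 // mul1r; apply: le_trans h1 _.
  by rewrite exprn_ege1 // ler1n.
have [E [W [chi [psi [g ts]]]]] :
    exists E W chi psi g, tilted_system v (kappa h) (tau h) E W chi psi g.
  apply: tilted_system_exists => //.
  - by rewrite /kappa; lra.
  - by rewrite /kappa; lra.
  - by move=> n; have := gap_gt0 h0 n; have := gh n; rewrite /tau => ? ?; apply/andP; split; lra.
  - move=> m n; rewrite leq_eqVlt => /predU1P[->//|mn].
    by have := gap_lt h0 mn; have := gap_gt0 h0 n; rewrite /tau; lra.
pose M := EquivalentNorm (seminorm_renorm h0 h1 ts) (norm_le_renorm h0 h1 ts) (renorm_le h0 h1 ts).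
have luc : locally_uniformly_convex (renormed M : completeNormedModType R).
  exact: (tilted_luc h0 h1 ts dv).
exists M; split => //.
- apply: renormed_isomorphic.
    by have [z nz] := infinite_dim_span [::] infY; exists z; apply/eqP.
  move=> x; apply: le_trans (renorm_le h0 h1 ts x) _.
  by rewrite ler_wpM2r // lerD2l.
- move=> K coK cK K2.
  have K0 : K !=set0 by case: K2 => x [y [Kx _ _]]; exists x.
  have [f [fu fc]] := nearest_point_exists (luc_strictly_convex luc) coK cK K0.
  exists f; split => //.
  have ME x : M x = renorm v h chi psi x by [].
  exact: (@tilted_not_unif _ _ _ _ _ _ _ _ _ M h0 h1 ts dv ME K f coK K2 fu.1).
Qed.

(** * The space of null sequences *)

Section NullSequences.
Context {R : realType}.

Definition null_seq : {pred nat -> R^o} := fun u =>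
  `[< forall e : R, 0 < e -> exists N, forall n, (N <= n)%N -> `|u n| < e >].

Lemma null_seqP (u : nat -> R^o) : reflect
  (forall e : R, 0 < e -> exists N, forall n, (N <= n)%N -> `|u n| < e) (u \in null_seq).
Proof. exact: asboolP. Qed.

Let null_seq_submod : submod_closed null_seq.
Proof.
split=> [|a u w /null_seqP u0 /null_seqP w0]; apply/null_seqP => e e0.
  by exists 0%N => n _; rewrite normr0.
have a1 : 0 < 2 * (`|a| + 1) by rewrite mulr_gt0 // ltr_wpDl.
have [N1 h1] := u0 _ (divr_gt0 e0 a1).
have [N2 h2] := w0 _ (divr_gt0 e0 (ltr0n _ 2)).
exists (maxn N1 N2) => n; rewrite geq_max => /andP[/h1 un /h2 wn].
apply: le_lt_trans (ler_normD _ _) _; rewrite normrM.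
move: un; rewrite ltr_pdivlMr // => un.
have := normr_ge0 (u n); move: un wn; rewrite mulrDr mulrC mulr1; lra.
Qed.

HB.instance Definition _ := GRing.isSubmodClosed.Build R (nat -> R^o) null_seq null_seq_submod.

(** A concrete infinite-dimensional separable Banach space to renorm; as a subtype cut out by a
    submodule it inherits its linear structure. *)
Record c0 := C0 { c0_val :> nat -> R^o; c0P : c0_val \in null_seq }.

HB.instance Definition _ := [isSub for c0_val].
HB.instance Definition _ := [Choice of c0 by <:].
HB.instance Definition _ := [SubChoice_isSubLmodule of c0 by <:].

Let coord (n : nat) (u : c0) : R := `|u n|.

Let seminorm_coord n : seminorm (coord n).
Proof. by split=> [x y|a x]; rewrite /coord /= ?ler_normD // normrM. Qed.

Let coord_bounded : pbounded coord.
Proof.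
move=> u; have [N hN] := null_seqP _ (c0P u) 1 ltr01.
exists (1 + \sum_(i < N) `|u i|) => n; rewrite /coord.
have [Nn|nN] := leqP N n.
  by apply: le_trans (ltW (hN n Nn)) _; rewrite lerDl sumr_ge0.
rewrite (bigD1 (Ordinal nN)) //= addrCA lerDl addr_ge0 //.
exact: sumr_ge0.
Qed.

Let norm0_eq0 (u : c0) : supn coord u = 0 -> u = 0.
Proof.
move=> u0; apply/val_inj/funext => n /=; apply/eqP; rewrite -normr_le0 -u0.
exact: (supn_ge n u coord_bounded).
Qed.

HB.instance Definition _ := Lmodule_isNormed.Build R c0
  (seminorm_supn coord_bounded seminorm_coord).1
  (seminorm_supn coord_bounded seminorm_coord).2 norm0_eq0.

Lemma c0_norm_ge (u : c0) n : `|u n| <= `|u|.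
Proof. exact: (supn_ge n u coord_bounded). Qed.

Lemma c0_norm_le (u : c0) (B : R) : (forall n, `|u n| <= B) -> `|u| <= B.
Proof. exact: supn_le. Qed.

Lemma c0_subE (u w : c0) n : (u - w) n = u n - w n. Proof. by []. Qed.

Let c0_complete (F : set_system c0) : ProperFilter F -> cauchy F -> cvg F.
Proof.
move=> PF /cauchyP Fc.
have ballF (e : R) : 0 < e -> exists x : c0, F [set u | `|x - u| < e].
  by move=> /Fc[x Fx]; exists x; move: Fx; rewrite -ball_normE.
have /choice[l lP] : forall n, exists r : R, forall e : R, 0 < e -> F [set u : c0 | `|r - u n| < e].
  move=> n; have cn : cauchy ((fun u : c0 => u n : R) @ F).
    apply/cauchyP => e /ballF[x Fx]; exists (x n).
    have : F [set u : c0 | ball (x n : R) e (u n)]; last by [].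
    apply: filterS Fx => u /= xu; rewrite -ball_normE /ball_ /=.
    by apply: le_lt_trans xu; exact: (c0_norm_ge (x - u) n).
  have /cvg_ex[r /cvgrPdist_lt h] : cvg ((fun u : c0 => u n : R) @ F) by exact: cauchy_cvg.
  by exists r.
(* The bound is uniform in [n], which turns coordinatewise limits into convergence in norm. *)
have close e (x : c0) n : F [set u | `|x - u| < e] -> `|l n - x n| <= e.
  move=> Fx; apply/ler_addgt0Pr => d d0.
  have [u [/= xu lu]] := filter_ex (filterI Fx (lP n d d0)).
  have := c0_norm_ge (x - u) n; rewrite c0_subE => xun.
  have -> : l n - x n = (l n - u n) - (x n - u n) by rewrite opprB addrA subrK.
  by apply: le_trans (ler_normB _ _) _; lra.
have l0 : (l : nat -> R^o) \in null_seq.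
  apply/null_seqP => e e0; have e2 : 0 < e / 2 by rewrite divr_gt0.
  have [x Fx] := ballF _ e2; have [N hN] := null_seqP _ (c0P x) _ e2.
  exists N => n /hN xn; rewrite -[l n](subrK (x n)).
  by apply: le_lt_trans (ler_normD _ _) _; have := close _ _ n Fx; lra.
apply/cvg_ex; exists (C0 l0); apply/cvgrPdist_lt => e e0.
have e2 : 0 < e / 2 by rewrite divr_gt0.
have [x Fx] := ballF _ e2; apply: filterS (Fx) => u /= xu.
rewrite -(subrKA x); apply: le_lt_trans (ler_normD _ _) _.
have : `|C0 l0 - x| <= e / 2 by apply: c0_norm_le => n; exact: close Fx.
lra.
Qed.

HB.instance Definition _ := Uniform_isComplete.Build c0 c0_complete.

Let finite_null_seq (s : seq R) : ((fun n => nth 0 s n) : nat -> R^o) \in null_seq.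
Proof.
apply/null_seqP => e e0; exists (size s) => n sn.
by rewrite nth_default // normr0.
Qed.

Definition c0_of_seq (s : seq R) : c0 := C0 (finite_null_seq s).

(** Finitely supported rational sequences are dense: cut off the tail, then round. *)
Lemma c0_separable : separable (c0 : normedModType R).
Proof.
exists [set c0_of_seq (map ratr s) | s in [set: seq rat]].
  by apply: sub_countable (card_image_le _ _) _; exact: countableP.
move=> O [x Ox] oO.
have [e /= e0 eO] : exists2 e : R, 0 < e & ball x e `<=` O.
  by apply/nbhs_ballP; exact: open_nbhs_nbhs.
have e2 : 0 < e / 2 by rewrite divr_gt0.
have [N hN] := null_seqP _ (c0P x) _ e2.
have /choice[r rP] : forall n, exists r : rat, `|x n - ratr r| < e / 2.
  move=> n; have [r] := @rat_in_itvoo R (x n - e / 2) (x n + e / 2) ltac:(lra).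
  by rewrite in_itv /= => /andP[r1 r2]; exists r; rewrite ltr_norml; apply/andP; split; lra.
exists (c0_of_seq (map ratr (mkseq r N))); split; last by exists (mkseq r N).
apply: eO; rewrite -ball_normE /ball_ /=.
apply: (@le_lt_trans _ _ (e / 2)); last by lra.
apply: c0_norm_le => n; rewrite c0_subE /=.
have [Nn|nN] := leqP N n.
  by rewrite nth_default ?size_map ?size_iota // subr0 ltW // hN.
by rewrite (nth_map 0) ?size_mkseq // nth_mkseq // ltW.
Qed.

(** Writing [n + 1] unit vectors through [n] spanning ones gives a matrix with a nonzero left
    kernel, hence a nontrivial relation between the unit vectors. *)
Lemma c0_infinite_dimensional : ~ finite_dimensional (c0 : lmodType R).
Proof.
move=> [n [b bP]].
pose delta (i : 'I_n.+1) := c0_of_seq (mkseq (fun k => (k == i)%:R) n.+1).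
have /choice[a aP] := fun i => bP (delta i).
pose A := \matrix_(i < n.+1, j < n) a i j.
have : kermx A != 0.
  rewrite kermx_eq0 /row_free neq_ltn; apply/orP; left.
  by rewrite ltnS rank_leq_col.
case/rowV0Pn => c /sub_kermxP cA; apply/negP; rewrite negbK.
have sum0 : \sum_i c ord0 i *: delta i = 0.
  under eq_bigr do rewrite aP scaler_sumr.
  rewrite exchange_big /= big1 // => j _.
  under eq_bigr do rewrite scalerA.
  rewrite -scaler_suml.
  have /matrixP/(_ ord0 j) := cA; rewrite !mxE => cj.
  suff -> : \sum_i c ord0 i * a i j = 0 by rewrite scale0r.
  by rewrite -[RHS]cj; apply: eq_bigr => i _; rewrite mxE.
have ev (I : finType) (F : I -> c0) k : (\sum_i F i) k = \sum_i F i k.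
  by elim/big_rec2 : _ => // i y z _ <-.
apply/eqP/rowP => k; rewrite mxE.
have deltaE i : (c ord0 i *: delta i) k = c ord0 i * (k == i)%:R.
  by rewrite -[X in _ = _ * X](nth_mkseq 0 (fun j => (j == i)%:R) (ltn_ord k)).
have := congr1 (fun u : c0 => u k) sum0; rewrite ev.
under eq_bigr do rewrite deltaE.
rewrite (bigD1 k) //= eqxx mulr1 big1 ?addr0 // => i ik.
by rewrite eq_sym (negbTE ik) mulr0.
Qed.

End NullSequences.

(** * Assembly of the two claims *)

Lemma separable_renormed {R : realType} (Y : completeNormedModType R)
    (M : @equivalent_norm R Y) :
  separable Y -> separable (renormed M : completeNormedModType R).
Proof.
move=> [D cD dD]; exists (D : set (renormed M)) => // O [x Ox] oO.
have idc : continuous ((fun z => z) : Y -> renormed M).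
  apply: (@lipschitz_continuous _ Y (renormed M) _ (enorm_bound M)) => y z.
  exact: enorm_le.
have oOY : open (O : set Y) := open_comp (fun z _ => idc z) oO.
by apply: dD => //; exists x.
Qed.

Theorem theoremA (R : realType) :
  (exists X : completeNormedModType R,
     [/\ exists x : X, x != 0,
         separable X,
         locally_uniformly_convex X
       & compact_convex_nearest_not_unif X])
  /\
  (forall Y : completeNormedModType R,
     ~ finite_dimensional Y -> separable Y ->
     forall eps : R, 0 < eps ->
     exists Z : completeNormedModType R,
       [/\ locally_uniformly_convex Z,
           isomorphic_with_const (1 + eps) Y Z
         & compact_convex_nearest_not_unif Z]).
Proof.
split; last first.
  move=> Y infY sepY eps eps0.
  by have [M [? ? ?]] := luc_renorming infY sepY eps0; exists (renormed M).
have [M [luc _ cc]] := luc_renorming (@c0_infinite_dimensional R)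
  (@c0_separable R) (@ltr01 R).
exists (renormed M); split => //; last exact: separable_renormed (@c0_separable R).
have [z nz] := infinite_dim_span [::] (@c0_infinite_dimensional R).
by exists z; apply/eqP.
Qed.
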